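(* For all sufficiently large $n$, for $(G,\lambda)\sim\mathcal F_{n,1}$, with probability at least $1-2n^{-\sqrt{\log n}}$, for every vertex $v$ and every $k\in[n-1]$ we have $$\left|\hat Y^v_k-\sum_{i=1}^k\frac{1}{i(n-i)+1}\right|\le\frac{2(\log n)^{0.8}}{n}.$$
   Context: $\mathcal F_{n,1}$ is the random temporal graph on $n$ labelled vertices whose underlying graph $G$ is the complete graph $K_n$, where each edge receives an independent time label $\lambda(e)$ uniform in $[0,1]$. A temporal graph $(T,\lambda')$ with $T$ a tree is an increasing temporal tree rooted at $v$ if every vertex of $T$ is reachable from $v$ by a path in $T$ whose labels are non-decreasing. For a vertex $v$, run the following process: $T^v_0=(\{v\},\emptyset)$; for $k=1,\dots,n-1$, let $S^v_k$ be the set of edges of $G$ with exactly one endpoint in $V(T^v_{k-1})$, let $e^v_k$ be the edge $e\in S^v_k$ of minimum $\lambda(e)$ among those for which $T^v_{k-1}\cup\{e\}$ is an increasing temporal tree rooted at $v$, and set $T^v_k=T^v_{k-1}\cup\{e^v_k\}$. Define $Y^v_0=0$, $Y^v_k=\lambda(e^v_k)$, $X^v_k=Y^v_k-Y^v_{k-1}$ for $k\in[n-1]$. Let $c_k=\frac{2\log(\min\{k,n-k\})+\log\log n}{k(n-k)}$, $\hat X^v_k=\min\{X^v_k,c_k\}$ and $\hat Y^v_k=\sum_{i=1}^k\hat X^v_i$. $\log$ is the natural logarithm and $[m]=\{1,\dots,m\}$. *)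

(* Defs.v *)
From HB Require Import structures.
From mathcomp Require Import all_boot all_order all_algebra.
From mathcomp Require Import all_classical all_reals all_analysis.

Set Implicit Arguments.
Unset Strict Implicit.
Unset Printing Implicit Defensive.

Import Order.TTheory GRing.Theory Num.Theory.

Local Open Scope ring_scope.

Record graph (V : finType) := Graph { vset : {set V}; eset : {set {set V}} }.

Definition complete_edges (V : finType) : {set {set V}} :=
  [set e : {set V} | #|e| == 2]%SET.

Section TemporalTrees.
Context {V : finType} {R : realType}.
Implicit Types (T : graph V) (lam : {set V} -> R) (e : {set V}).

Definition adj T : rel V := fun x y => ([set x; y]%SET \in eset T).

Definition is_tree T : Prop :=
  [/\ forall e, e \in eset T -> #|e| = 2%N /\ e \subset vset T,
      forall x y, x \in vset T -> y \in vset T -> connect (adj T) x y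
    & forall c : seq V, (2 < size c)%N -> ~~ ucycleb (adj T) c].

(* [x :: p] is a path of T; [pairmap] lists the labels of its successive edges *)
Definition increasing_path T lam x (p : seq V) : Prop :=
  [/\ path (adj T) x p, uniq (x :: p)
    & sorted <=%R (pairmap (fun y z => lam [set y; z]%SET) x p)].

Definition increasing_tree lam v T : Prop :=
  [/\ is_tree T, v \in vset T
    & forall u, u \in vset T ->
        exists2 p : seq V, increasing_path T lam v p & last v p = u].

Definition add_edge T e : graph V := Graph (vset T :|: e)%SET (e |: eset T)%SET.

Definition boundary (E : {set {set V}}) T : {set {set V}} :=
  [set e in E | #|e :&: vset T| == 1%N]%SET.

(* The default [set0] is the value only when no edge of E is admissible.  For
   the complete graph this does not happen while vset T is not everything: an
   edge from v to a vertex outside T is always admissible.  Equal labels, an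
   event of probability 0 below, are resolved by the choice made in arg min. *)
Definition next_edge (E : {set {set V}}) lam v T : {set V} :=
  [arg min_(e < finset.set0 | (e \in boundary E T) &&
                       `[< increasing_tree lam v (add_edge T e) >]) lam e]%O.

Definition tree_seq E lam v (k : nat) : graph V :=
  iter k (fun T => add_edge T (next_edge E lam v T)) (Graph [set v]%SET finset.set0).

Definition Yseq E lam v (k : nat) : R :=
  if k is k'.+1 then lam (next_edge E lam v (tree_seq E lam v k')) else 0.

Definition Xseq E lam v (k : nat) : R :=
  Yseq E lam v k - Yseq E lam v k.-1.

End TemporalTrees.

Section Truncation.
Context {R : realType} {n : nat}.
Implicit Types (lam : {set 'I_n} -> R) (v : 'I_n) (k : nat).

Definition ck k : R :=
  (2 * ln (minn k (n - k))%:R + ln (ln n%:R)) / (k * (n - k))%:R.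

Definition hatX lam v k : R :=
  Num.min (Xseq (complete_edges 'I_n) lam v k) (ck k).

Definition hatY lam v k : R := \sum_(1 <= i < k.+1) hatX lam v i.

End Truncation.

(* mutual independence of the real random variables X i, i \in J *)
Definition mutually_independent d (T : measurableType d) (R : realType)
    (P : probability T R) (I : finType) (J : {set I}) (X : I -> T -> R) : Prop :=
  forall (K : {set I}) (A : I -> set R), K \subset J ->
    (forall i, measurable (A i)) ->
    P (\bigcap_(i in [set` K]) (X i @^-1` A i))%classic =
    (\prod_(i in K) P (X i @^-1` A i)%classic)%E.

(* The random temporal graph with underlying graph the complete graph on 'I_n
   and independent labels uniform in [0, 1].  Labels are indexed by all vertex
   sets; only those of the two-element sets are constrained and used. *)
Definition random_temporal_clique d (T : measurableType d) (R : realType)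
    (P : probability T R) (n : nat) (lambda : {set 'I_n} -> {RV P >-> R}) : Prop :=
  mutually_independent P (complete_edges 'I_n) (fun e => lambda e : T -> R) /\
  forall e, e \in complete_edges 'I_n ->
    forall A : set R, measurable A ->
      distribution P (lambda e) A = uniform_prob (@ltr01 R) A.

(* Main.v *)
Require Import Defs.
From mathcomp Require Import all_boot all_order all_algebra.
From mathcomp Require Import all_classical all_reals all_analysis.
From mathcomp Require Import measurable_realfun zify ring lra.

(** Fix a root.  The process is foremost-path exploration: a boundary edge whose
    inner endpoint has arrival label [a] is admissible iff its label is at least
    [a], and every boundary edge with label between [a] and the current label
    [Y] has been used already.  Hence, given the history and the labels off the
    boundary, each boundary edge is conditioned only to avoid [[a, Y]], so that
    [X_{k+1} > x] has conditional probability at most [(1 - x)^m] and at least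
    [(1 - x/(1 - Y))^m], where [m = (k+1)(n-k-1)].  Integrating in [x] gives
    one-sided bounds on the conditional mean of the truncated increment, both
    close to [1/(m+1)] while [Y] is small; an exponential moment argument with
    the increment bounds [c_k] gives concentration, and a union bound over the
    roots and the steps concludes.

    To avoid conditional expectations, the labels are rounded to a grid of mesh
    [1/M] with [M] huge.  Conditioning then is counting: configurations with the
    same history and the same labels off the boundary form a box. *)

Set Implicit Arguments.
Unset Strict Implicit.
Unset Printing Implicit Defensive.

Import Order.TTheory GRing.Theory Num.Theory.

Local Open Scope ring_scope.

(** * Exploration of increasing trees *)

Lemma arg_min_spec (R : realType) (I : finType) (i0 i1 : I) (P : pred I) (F : I -> R) :
  P i1 -> P (Order.arg_min i0 P F) /\ forall i, P i -> F (Order.arg_min i0 P F) <= F i.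
Proof.
move=> Pi1; suff -> : Order.arg_min i0 P F = Order.arg_min i1 P F.
  by case: (arg_minP F Pi1).
rewrite /Order.arg_min /extremum; case: pickP => [//|no].
case: (arg_minP F Pi1) => i Pi mi; have := no i.
by rewrite /= Pi /= => /negbT/forallP[] j; apply/implyP => /mi.
Qed.

Lemma eq_arg_min (R : realType) (I : finType) (i0 : I) (P Q : pred I) (F G : I -> R) :
  P =1 Q -> {in P &, forall i j, (F i <= F j) = (G i <= G j)} ->
  Order.arg_min i0 P F = Order.arg_min i0 Q G.
Proof.
move=> PQ FG; rewrite /Order.arg_min /extremum; congr odflt; apply: eq_pick => i /=.
rewrite -PQ; case: (boolP (P i)) => //= Pi; apply: eq_forallb => j.
by rewrite -PQ; case: (boolP (P j)) => //= Pj; apply: FG.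
Qed.

Section Process.
Variables (V : finType) (R : realType).
Implicit Types (T : graph V) (lam : {set V} -> R) (v u w : V) (e f : {set V}).

Lemma set2_edge u w : u != w -> [set u; w]%SET \in complete_edges V.
Proof. by move=> uw; rewrite inE cards2 uw. Qed.

Section OrderInvariance.
Variables (lam lam' : {set V} -> R) (v : V).
Local Notation E := (complete_edges V).
Hypothesis same : {in E &, forall e f, (lam e <= lam f) = (lam' e <= lam' f)}.

Lemma increasing_path_order T x p : (forall y z, adj T y z -> [set y; z]%SET \in E) ->
  increasing_path T lam x p -> increasing_path T lam' x p.
Proof.
move=> adjE [pth un srt]; split=> //.
have pE (mu : {set V} -> R) :
    pairmap (fun y z => mu [set y; z]%SET) x p =
    map mu (pairmap (fun y z => [set y; z]%SET) x p).
  by elim: p x {pth un srt} => //= z p IH x; rewrite IH.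
move: srt; rewrite !pE !sorted_map.
suff allE : all (mem E) (pairmap (fun y z => [set y; z]%SET) x p).
  by rewrite (eq_in_sorted (P := mem E) (e' := relpre lam' <=%R)).
elim: p x pth {un pE} => //= z p IH x /andP[/adjE xz /IH ->].
by rewrite andbT; exact: xz.
Qed.
End OrderInvariance.

Lemma increasing_tree_order lam lam' v T :
  {in complete_edges V &, forall e f, (lam e <= lam f) = (lam' e <= lam' f)} ->
  (forall y z, adj T y z -> [set y; z]%SET \in complete_edges V) ->
  increasing_tree lam v T -> increasing_tree lam' v T.
Proof.
move=> same adjE [Tt vT inc]; split=> // u /inc[p incp lastp]; exists p => //.
exact: increasing_path_order incp.
Qed.

Lemma next_edge_cases E lam v T : next_edge E lam v T \in (finset.set0 |: E)%SET.
Proof.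
rewrite /next_edge /Order.arg_min /extremum; case: pickP => /= [e|_].
  by rewrite !inE -!andbA => /andP[-> _]; rewrite orbT.
by rewrite !inE eqxx.
Qed.

Lemma tree_seq_edges lam v k :
  eset (tree_seq (complete_edges V) lam v k) \subset (finset.set0 |: complete_edges V)%SET.
Proof.
elim: k => [|k IH]; first by rewrite /= finset.sub0set.
rewrite /tree_seq iterS -/(tree_seq _ _ _ _) /= finset.subUset IH finset.sub1set andbT.
exact: next_edge_cases.
Qed.

Lemma next_edge_order lam lam' v T :
  {in complete_edges V &, forall e f, (lam e <= lam f) = (lam' e <= lam' f)} ->
  eset T \subset (finset.set0 |: complete_edges V)%SET ->
  next_edge (complete_edges V) lam v T = next_edge (complete_edges V) lam' v T.
Proof.
move=> same sub; have same' :
    {in complete_edges V &, forall e f, (lam' e <= lam' f) = (lam e <= lam f)}.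
  by move=> e f eE fE; rewrite same.
apply: eq_arg_min => [e|e f]; last first.
  move=> /andP[] /=; rewrite finset.in_set => /andP[eE _] _.
  by move=> /andP[] /=; rewrite finset.in_set => /andP[fE _] _; exact: same.
case: (boolP (e \in boundary _ _)) => //=; rewrite finset.in_set => /andP[eE _].
have adjE y z : adj (add_edge T e) y z -> [set y; z]%SET \in complete_edges V.
  rewrite /adj /= finset.in_setU1 => /orP[/eqP -> //|/(fintype.subsetP sub)].
  rewrite finset.in_setU1 => /orP[/eqP /setP /(_ y)|//].
  by rewrite !inE eqxx.
by apply/asboolP/asboolP; apply: increasing_tree_order.
Qed.

Lemma tree_seq_order lam lam' v k :
  {in complete_edges V &, forall e f, (lam e <= lam f) = (lam' e <= lam' f)} ->
  tree_seq (complete_edges V) lam v k = tree_seq (complete_edges V) lam' v k.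
Proof.
move=> same; elim: k => [//|k IH]; rewrite /tree_seq !iterS -!/(tree_seq _ _ _ _) -IH.
by rewrite (next_edge_order v same) // tree_seq_edges.
Qed.

End Process.

Section Leaf.
Variables (V : finType) (R : realType) (T : graph V) (u w : V).
Hypotheses (Tt : is_tree T) (uT : u \in vset T) (wT : w \notin vset T).
Local Notation T' := (add_edge T [set u; w]%SET).

Lemma adj_vset x y : adj T x y -> (x \in vset T) && (y \in vset T).
Proof.
case: Tt => sub _ _ /sub[_ /fintype.subsetP xyT].
by rewrite !xyT // !inE eqxx ?orbT.
Qed.

Lemma leaf_neq : u != w. Proof. by apply: contraNneq wT => <-. Qed.

Lemma adjC (T0 : graph V) x y : adj T0 x y = adj T0 y x.
Proof. by rewrite /adj finset.setUC. Qed.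

Lemma adj_leaf x : adj T' x w -> x = u.
Proof.
rewrite /adj /= finset.in_setU1 => /orP[/eqP/setP xw|/adj_vset]; last by rewrite (negPf wT) andbF.
have := xw u; rewrite !inE eqxx (negPf leaf_neq) orbF /= => /eqP; exact: esym.
Qed.

Lemma adj_nonleaf x y : x != w -> y != w -> adj T' x y = adj T x y.
Proof.
move=> xw yw; rewrite /adj /= finset.in_setU1; case: eqP => //= /setP /(_ w).
by rewrite !inE eqxx orbT eq_sym (negPf xw) eq_sym (negPf yw).
Qed.

Lemma path_nonleaf x p : w \notin x :: p -> path (adj T') x p = path (adj T) x p.
Proof.
elim: p x => //= y p IH x; rewrite !inE !negb_or => /and3P[xw yw wp].
by rewrite adj_nonleaf 1?eq_sym // IH // inE negb_or yw.
Qed.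

Lemma leaf_notin_path x p :
  x != w -> uniq (x :: p) -> path (adj T') x p -> last x p != w -> w \notin p.
Proof.
move=> xw un pth lastp; apply/negP => wp.
case/splitPr: wp un pth lastp => p1 p2.
case: p2 => [|z p2]; first by rewrite last_cat /= eqxx.
rewrite -cat_cons cat_uniq cat_path => /and3P[_ /hasPn/(_ z) no _] /= /and4P[_ aw wz _] _.
move: wz; rewrite adjC => /adj_leaf zu; move/adj_leaf in aw.
by move: no; rewrite !inE eqxx orbT zu -aw => /(_ isT); rewrite -in_cons mem_last.
Qed.

Lemma path_to_leaf x p : x != w -> uniq (x :: p) -> path (adj T') x p -> last x p = w ->
  exists2 q, p = rcons q w & [/\ path (adj T) x q, uniq (x :: q), w \notin x :: q & last x q = u].
Proof.
move=> xw; case/lastP: p => [|q z]; first by move=> _ _ /= /eqP; rewrite (negPf xw).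
rewrite last_rcons => un pth zw; subst z; exists q => //.
move: un pth; rewrite -rcons_cons rcons_uniq rcons_path => /andP[wq un] /andP[pth /adj_leaf ->].
by split=> //; rewrite -path_nonleaf.
Qed.

Lemma leaf_is_tree : is_tree T'.
Proof.
case: (Tt) => sub con cyc; split.
- move=> e; rewrite finset.in_setU1 => /orP[/eqP ->|/sub[-> eT]].
    by rewrite cards2 leaf_neq finset.subsetUr.
  by split => //; apply: fintype.subset_trans eT (finset.subsetUl _ _).
- have conT x y : x \in vset T -> y \in vset T -> connect (adj T') x y.
    move=> xT yT; apply: connect_sub (con _ _ xT yT) => a b ab.
    have /andP[aT bT] := adj_vset ab; apply: connect1.
    by rewrite adj_nonleaf //; apply: contraNneq wT => <-.
  have uw : connect (adj T') u w by apply: connect1; rewrite /adj finset.setU11.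
  have wu : connect (adj T') w u by apply: connect1; rewrite adjC /adj finset.setU11.
  have vT' x : x \in vset T' -> x = w \/ x \in vset T.
    by rewrite !inE => /or3P[->|/eqP ->|/eqP ->]; [right|right|left].
  move=> x y /vT'[->|xT] /vT'[->|yT]; rewrite ?connect0 //.
  + exact: connect_trans wu (conT _ _ uT yT).
  + exact: connect_trans (conT _ _ xT uT) uw.
  + exact: conT.
- move=> c sc; apply/negP => /andP[cyc' un].
  have [wc|wc] := boolP (w \in c); last first.
    have /negP := cyc _ sc; apply; rewrite /ucycleb un andbT.
    case: c {sc un} wc cyc' => //= x c wc; rewrite path_nonleaf //.
    by move: wc; rewrite !inE mem_rcons inE negb_or => /andP[/negPf -> /negPf ->].
  case: (rot_to wc) => i c' rc.
  have := cyc'; rewrite -(rot_cycle i) rc; have := un; rewrite -(rot_uniq i) rc.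
  have : (2 < size (w :: c'))%N by rewrite -rc size_rot.
  case: c' {rc} => // z c' /= sz /andP[_] /andP[zc _].
  rewrite rcons_path => /andP[]; rewrite adjC => /adj_leaf zu /andP[_ /adj_leaf lu].
  case: c' sz zc lu => //= y c' _; rewrite zu => /negP + lu; apply.
  by rewrite -lu; exact: mem_last.
Qed.
End Leaf.

Section Labels.
Variables (V : finType) (R : realType) (lam : {set V} -> R).

Definition labels x (p : seq V) := pairmap (fun y z => lam [set y; z]%SET) x p.

Lemma labels_rcons x p z : labels x (rcons p z) = rcons (labels x p) (lam [set last x p; z]%SET).
Proof. by rewrite -cats1 /labels pairmap_cat /= cats1. Qed.

Lemma sorted_rcons_le (s : seq R) z x0 : all (>= x0) s -> x0 <= z ->
  sorted <=%R (rcons s z) = sorted <=%R s && (last x0 s <= z).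
Proof.
case: s => [|y s] /=; first by move=> _ ->.
by move=> _ _; rewrite rcons_path.
Qed.

(* The arrival label [a u] of a vertex is the label of the last edge on the
   unique path from the root to it. *)
Definition arrival v T (a : V -> R) :=
  forall p, path (adj T) v p -> uniq (v :: p) -> last 0 (labels v p) = a (last v p).

Hypothesis lam_ge0 : forall e, e \in complete_edges V -> 0 <= lam e.

Lemma labels_ge0 T x p : is_tree T -> path (adj T) x p -> all (>= 0) (labels x p).
Proof.
move=> [sub _ _]; elim: p x => //= z p IH x /andP[/sub[xz _] /IH ->].
by rewrite andbT; apply: lam_ge0; rewrite inE xz.
Qed.

Variables (v : V) (T : graph V) (u w : V) (a : V -> R).
Hypotheses (Tt : increasing_tree lam v T) (Ta : arrival v T a).
Hypotheses (uT : u \in vset T) (wT : w \notin vset T).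
Local Notation T' := (add_edge T [set u; w]%SET).

Let Ttree : is_tree T. Proof. by case: Tt. Qed.
Let vT : v \in vset T. Proof. by case: Tt. Qed.
Let vw : v != w. Proof. by apply: contraNneq wT => <-. Qed.
Let uw : u != w. Proof. by apply: contraNneq wT => <-. Qed.

Lemma increasing_tree_leaf : increasing_tree lam v T' <-> a u <= lam [set u; w]%SET.
Proof.
have inE' : [set u; w]%SET \in complete_edges V by apply: set2_edge.
split=> [[_ _ /(_ w)]|au].
  rewrite !inE eqxx !orbT => /(_ isT)[p [pth un srt] lastp].
  have [q pq [pthq unq wq lastq]] := path_to_leaf Ttree uT wT vw un pth lastp.
  move: srt; rewrite -/(labels v p) pq labels_rcons lastq (@sorted_rcons_le _ _ 0).
  - by rewrite Ta // lastq => /andP[].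
  - exact: labels_ge0 pthq.
  - exact: lam_ge0.
have adjT x y : adj T x y -> adj T' x y by rewrite /adj /= finset.in_setU1 => ->; rewrite orbT.
split; first exact: leaf_is_tree.
  by rewrite !inE vT.
have [_ _ inc] := Tt => x.
have incT y : y \in vset T -> exists2 p, increasing_path T' lam v p & last v p = y.
  by move=> /inc[p [pth un srt] lastp]; exists p => //; split=> //; apply: sub_path pth.
rewrite !inE => /or3P[/incT //|/eqP -> |/eqP ->]; first exact: incT.
have [p [pth un srt] lastp] := inc _ uT.
have wp : w \notin v :: p.
  rewrite inE eq_sym (negPf vw) /=; apply/negP => wp.
  have : all (mem (vset T)) p.
    elim: (p) (v) pth => //= z q IH x0 /andP[/(adj_vset Ttree)/andP[_ zT] /IH ->].
    by rewrite andbT; exact: zT.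
  by move/allP => /(_ _ wp) /=; rewrite (negPf wT).
exists (rcons p w); last by rewrite last_rcons.
split.
- rewrite rcons_path lastp (sub_path adjT pth) /=.
  by rewrite /adj /= finset.setU11.
- by rewrite -rcons_cons rcons_uniq wp.
- rewrite -/(labels _ _) labels_rcons lastp (@sorted_rcons_le _ _ 0).
  + by rewrite Ta // lastp au andbT.
  + exact: labels_ge0 pth.
  + exact: lam_ge0.
Qed.

Lemma arrival_leaf :
  arrival v T' (fun x => if x \in vset T then a x else lam [set u; w]%SET).
Proof.
move=> p pth un; have [lw|lw] := eqVneq (last v p) w.
  have [q pq [pthq unq wq lastq]] := path_to_leaf Ttree uT wT vw un pth lw.
  by rewrite lw (negPf wT) pq labels_rcons last_rcons lastq.
have wp := leaf_notin_path Ttree uT wT vw un pth lw.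
have pthT : path (adj T) v p.
  by rewrite -(@path_nonleaf _ T u w) // inE negb_or eq_sym vw.
have -> : last v p \in vset T; last exact: Ta.
case/lastP: p pthT {pth un lw wp} => // p z; rewrite last_rcons rcons_path => /andP[_].
by move=> /(adj_vset Ttree)/andP[].
Qed.
End Labels.

Section Exploration.
Variables (V : finType) (R : realType).
Implicit Types (lam : {set V} -> R) (v : V) (k : nat).

Definition tree lam v k := tree_seq (complete_edges V) lam v k.
Definition new_edge lam v k := next_edge (complete_edges V) lam v (tree lam v k).

Fixpoint arr lam v k : V -> R :=
  if k is k'.+1 then
    fun x => if x \in vset (tree lam v k') then arr lam v k' x else lam (new_edge lam v k')
  else fun=> 0.

Definition bdry lam v k := boundary (complete_edges V) (tree lam v k).

(* For [f] in the boundary, the arrival label of its endpoint inside the tree. *)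
Definition low lam v k f := \sum_(u in (f :&: vset (tree lam v k))%SET) arr lam v k u.

Lemma treeS lam v k : tree lam v k.+1 = add_edge (tree lam v k) (new_edge lam v k).
Proof. by rewrite /tree /tree_seq iterS. Qed.

Lemma bdryP lam v k f :
  reflect (exists u w, [/\ u \in vset (tree lam v k), w \notin vset (tree lam v k) & f = [set u; w]%SET])
    (f \in bdry lam v k).
Proof.
rewrite finset.in_set finset.in_set; set A := vset _.
apply: (iffP andP) => [[/cards2P[x [y [xy ->]]]]|[u [w [uA wA ->]]]]; last first.
  have uw : u != w by apply: contraNneq wA => <-.
  rewrite cards2 uw; split=> //; apply/cards1P; exists u; apply/setP => z; rewrite !inE.
  by case: (eqVneq z u) => [->|_] //=; case: (eqVneq z w) => [->|] //=; rewrite (negPf wA).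
have [xA|xA] := boolP (x \in A); have [yA|yA] := boolP (y \in A).
- by rewrite (finset.setIidPl _) ?cards2 ?xy // finset.subUset !finset.sub1set xA.
- by exists x, y.
- by exists y, x; split=> //; rewrite finset.setUC.
- rewrite (_ : (_ :&: _)%SET = finset.set0) ?cards0 //; apply/setP => z; rewrite !inE.
  by case: (eqVneq z x) => [->|_] /=; [rewrite (negPf xA)|
     case: (eqVneq z y) => [->|] //=; rewrite (negPf yA)].
Qed.

Lemma bdry_edge lam v k f : f \in bdry lam v k -> f \in complete_edges V.
Proof. by rewrite finset.in_set => /andP[]. Qed.

Lemma lowE lam v k u w : u \in vset (tree lam v k) -> w \notin vset (tree lam v k) ->
  low lam v k [set u; w]%SET = arr lam v k u.
Proof.
move=> uA wA; rewrite /low (_ : (_ :&: _)%SET = [set u]%SET) ?big_set1 //.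
apply/setP => z; rewrite !inE.
by case: (eqVneq z u) => [->|_] //=; case: (eqVneq z w) => [->|] //=; rewrite (negPf wA).
Qed.

Section Fixed.
Variables (lam : {set V} -> R) (v : V).
Hypothesis lam_gt0 : forall e, e \in complete_edges V -> 0 < lam e.
Local Notation T := (tree lam v).
Local Notation Y := (Yseq (complete_edges V) lam v).
Local Notation S := (bdry lam v).

Let lam_ge0 e : e \in complete_edges V -> 0 <= lam e. Proof. by move=> /lam_gt0/ltW. Qed.

Lemma YseqS k : Y k.+1 = lam (new_edge lam v k). Proof. by []. Qed.

Definition explored k :=
  [/\ increasing_tree lam v (T k), arrival lam v (T k) (arr lam v k) & #|vset (T k)| = k.+1].

Lemma admissible_low k f : explored k -> f \in S k ->
  `[< increasing_tree lam v (add_edge (T k) f) >] = (low lam v k f <= lam f).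
Proof.
move=> [Tk ak _] /bdryP[u [w [uA wA ->]]]; rewrite lowE //.
by apply/asboolP/idP => /(increasing_tree_leaf lam_ge0 Tk ak uA wA).
Qed.

Lemma explored_root k : explored k -> v \in vset (T k) /\ arr lam v k v = 0.
Proof. by case=> -[_ vT _] ak _; split=> //; rewrite -(ak [::]). Qed.

Lemma root_edge k : explored k -> (k.+1 < #|V|)%N ->
  exists2 f, f \in S k & low lam v k f = 0.
Proof.
move=> Ek kn; have [vT av] := explored_root Ek; case: Ek => _ _ cT.
have [w wT] : exists w, w \notin vset (T k).
  apply/existsP; apply: contraLR kn => /existsPn H; rewrite -leqNgt -cT.
  by apply: subset_leq_card; apply/fintype.subsetP => x _; have := H x; rewrite negbK.
exists [set v; w]%SET; last by rewrite lowE.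
by apply/bdryP; exists v, w.
Qed.

Lemma next_spec_aux k : explored k -> (k.+1 < #|V|)%N ->
  [/\ new_edge lam v k \in S k, low lam v k (new_edge lam v k) <= lam (new_edge lam v k)
    & forall f, f \in S k -> low lam v k f <= lam f -> lam (new_edge lam v k) <= lam f].
Proof.
move=> Ek kn; have [f fS f0] := root_edge Ek kn.
have := @arg_min_spec R _ finset.set0 f (fun e => (e \in S k) &&
   `[< increasing_tree lam v (add_edge (T k) e) >]) lam.
rewrite fS admissible_low // f0 lam_ge0 ?(bdry_edge fS) // => /(_ isT).
rewrite -/(next_edge _ _ _ _) -/(new_edge lam v k) => -[/andP[nS]].
rewrite admissible_low // => nl nmin; split=> // e eS el.
by apply: nmin; rewrite eS admissible_low.
Qed.

Lemma exploredP k : (k < #|V|)%N -> explored k.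
Proof.
elim: k => [|k IH] kn.
  split; last by rewrite cards1.
  - split=> /=; last 1 first.
    + by move=> u; rewrite inE => /eqP ->; exists [::].
    + split=> /= [e|x y|c sc]; first by rewrite inE.
        by rewrite !inE => /eqP -> /eqP ->.
      case: c sc => [|x [|y c]] //= _; rewrite /ucycleb /= /adj /=.
      by rewrite finset.in_set0.
    + by rewrite inE.
  - by case=> //= x p; rewrite /adj /= finset.in_set0.
have Ek := IH (ltnW kn).
have [/bdryP[u [w [uT wT nE]]] nlow _] := next_spec_aux Ek kn.
case: Ek => Tk ak cT; rewrite /explored treeS; split.
- rewrite nE; apply/(increasing_tree_leaf lam_ge0 Tk ak uT wT).
  by rewrite -nE; move: nlow; rewrite [X in low _ _ _ X]nE lowE.
- by have := arrival_leaf (lam := lam) Tk ak uT wT; rewrite -nE.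
- rewrite nE /= (_ : (_ :|: _)%SET = (w |: vset (T k))%SET).
    by rewrite cardsU1 wT cT.
  apply/setP => z; rewrite !inE; case: (eqVneq z u) => [->|] //=.
    by rewrite uT !orbT.
  by rewrite orbC.
Qed.

Lemma next_spec k : (k.+1 < #|V|)%N ->
  [/\ new_edge lam v k \in S k, low lam v k (new_edge lam v k) <= lam (new_edge lam v k)
    & forall f, f \in S k -> low lam v k f <= lam f -> lam (new_edge lam v k) <= lam f].
Proof. by move=> kn; apply: next_spec_aux => //; apply: exploredP; exact: ltnW. Qed.

Lemma tree_sub i k : (i <= k)%N -> vset (T i) \subset vset (T k).
Proof.
elim: k => [|k IH]; first by rewrite leqn0 => /eqP ->.
rewrite leq_eqVlt => /orP[/eqP -> //|/IH sub].
by rewrite treeS; apply: fintype.subset_trans sub (finset.subsetUl _ _).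
Qed.

Lemma next_bdry_edge k : (k.+1 < #|V|)%N -> new_edge lam v k \in complete_edges V.
Proof. by move=> /next_spec[/bdry_edge]. Qed.

Lemma next_in_tree i k : (i < k)%N -> new_edge lam v i \subset vset (T k).
Proof. by move=> ik; apply: fintype.subset_trans (tree_sub ik); rewrite treeS finset.subsetUr. Qed.

Lemma next_notin_bdry i k : (i < k)%N -> (i.+1 < #|V|)%N -> new_edge lam v i \notin S k.
Proof.
move=> ik iV; have nsub := next_in_tree ik; rewrite finset.in_set (finset.setIidPl nsub).
by have := next_bdry_edge iV; rewrite finset.in_set => /eqP ->.
Qed.

Hypothesis lam_inj : {in complete_edges V &, injective lam}.

Lemma bdry_label k f : (k < #|V|)%N -> f \in S k -> low lam v k f <= lam f -> Y k < lam f.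
Proof.
elim: k f => [|k IH] f kn fS; first by move=> _; exact: lam_gt0 (bdry_edge fS).
have [nS nlow nmin] := next_spec kn.
have neq : lam (new_edge lam v k) != lam f.
  apply: contraTneq (fS) => /(lam_inj (bdry_edge nS) (bdry_edge fS)) <-.
  exact: next_notin_bdry.
case/bdryP: (fS) => u [w [uT wT fE]]; rewrite {1}fE lowE //= -/(tree _ _ _) -/(new_edge _ _ _).
rewrite lt_neqAle neq /=.
have [uk ul|_ //] := boolP (u \in vset (T k)).
have wk : w \notin vset (T k) by apply: contra wT; apply/fintype.subsetP/tree_sub.
apply: nmin; first by apply/bdryP; exists u, w.
by rewrite {1}fE lowE.
Qed.

Lemma Yseq_lt k : (k.+1 < #|V|)%N -> Y k < Y k.+1.
Proof. by move=> kn; have [nS nl _] := next_spec kn; apply: bdry_label => //; exact: ltnW. Qed.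

Lemma Yseq_le i k : (i <= k)%N -> (k < #|V|)%N -> Y i <= Y k.
Proof.
elim: k => [|k IH]; first by rewrite leqn0 => /eqP ->.
rewrite leq_eqVlt => /orP[/eqP -> //|ik] kn.
by apply: le_trans (IH ik (ltnW kn)) _; exact: ltW (Yseq_lt kn).
Qed.

Lemma next_uniq k e : (k.+1 < #|V|)%N -> e \in S k -> low lam v k e <= lam e ->
  (forall f, f \in S k -> low lam v k f <= lam f -> lam e <= lam f) -> new_edge lam v k = e.
Proof.
move=> kn eS el emin; have [nS nl nmin] := next_spec kn.
apply: lam_inj; [exact: bdry_edge nS|exact: bdry_edge eS|].
by apply/eqP; rewrite eq_le nmin // emin.
Qed.

Lemma Xseq_gt k x : (k.+1 < #|V|)%N -> 0 <= x ->
  (x < Xseq (complete_edges V) lam v k.+1) =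
  [forall f in S k, (lam f < low lam v k f) || (Y k + x < lam f)].
Proof.
move=> kn x0; rewrite /Xseq ltrBrDl [k.+1.-1]/=; have [nS nl nmin] := next_spec kn.
apply/idP/'forall_implyP => [lt f fS|/(_ _ nS)].
  by case: ltP => //= fl; apply: lt_le_trans lt (nmin _ fS fl).
by case: ltP nl.
Qed.

Lemma arr_le k u : (k < #|V|)%N -> u \in vset (T k) -> 0 <= arr lam v k u <= Y k.
Proof.
elim: k u => [|k IH] u kn; first by rewrite lexx.
rewrite treeS /= -/(new_edge _ _ _); case: ifP => uk.
  move=> _; have /andP[-> au] := IH u (ltnW kn) uk.
  exact: le_trans au (ltW (Yseq_lt kn)).
by rewrite lexx lam_ge0 // next_bdry_edge.
Qed.

Lemma low_le k f : (k < #|V|)%N -> f \in S k -> 0 <= low lam v k f <= Y k.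
Proof. by move=> kn /bdryP[u [w [uT wT ->]]]; rewrite lowE //; exact: arr_le. Qed.

Lemma card_bdry k : (k < #|V|)%N -> #|S k| = (k.+1 * (#|V| - k.+1))%N.
Proof.
move=> kn; have [_ _ cT] := exploredP kn.
rewrite -cT -(cardsC (vset (T k))) addKn -cardsX.
rewrite -(card_in_imset (f := fun p : V * V => [set p.1; p.2]%SET)); last first.
  move=> [x y] [x' y']; rewrite !finset.in_setX !inE /= => /andP[xT yT] /andP[xT' yT'] /setP H.
  have := H x; have := H y; rewrite !inE !eqxx /= orbT.
  case: (eqVneq y x') => [e|_]; first by rewrite e xT' in yT.
  move=> /esym/eqP <-; case: (eqVneq x y) => [e|_]; first by rewrite -e xT in yT.
  by rewrite orbF => /esym/eqP <-.
apply: eq_card => f; apply/bdryP/imsetP => [[u [w [uT wT ->]]]|[[x y]]].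
  by exists (u, w) => //; rewrite !inE /= uT.
by rewrite !inE /= => /andP[xT yT] ->; exists x, y.
Qed.

End Fixed.

Section Resample.
Variables (lam lam' : {set V} -> R) (v : V) (k : nat).
Hypotheses (lam_gt0 : forall e, e \in complete_edges V -> 0 < lam e)
  (lam_gt0' : forall e, e \in complete_edges V -> 0 < lam' e)
  (lam_inj : {in complete_edges V &, injective lam})
  (lam_inj' : {in complete_edges V &, injective lam'}).
Hypotheses (kn : (k < #|V|)%N)
  (agree : forall e, e \in complete_edges V -> e \notin bdry lam v k -> lam' e = lam e).
Local Notation E := (complete_edges V).

Local Notation history i :=
  (forall j, (j < i)%N -> new_edge lam' v j = new_edge lam v j).

Lemma history_tree i : history i -> tree lam' v i = tree lam v i.
Proof.
elim: i => [//|i IH] hi; rewrite !treeS hi // IH // => j ji; apply: hi; exact: ltnW.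
Qed.

Lemma history_Yseq i : (i <= k)%N -> history i -> Yseq E lam' v i = Yseq E lam v i.
Proof.
case: i => // i ik hi; rewrite !YseqS hi // agree //.
  by apply: next_bdry_edge => //; apply: leq_ltn_trans kn.
by apply: next_notin_bdry => //; apply: leq_ltn_trans kn.
Qed.

Lemma history_arr i : (i <= k)%N -> history i -> arr lam' v i =1 arr lam v i.
Proof.
elim: i => [//|i IH] ik hi x /=; have hi' : history i by move=> j ji; apply: hi; exact: ltnW.
rewrite history_tree // IH 1?ltnW //; case: ifP => // _.
by have := history_Yseq ik hi.
Qed.

Lemma history_low i : (i <= k)%N -> history i -> low lam' v i =1 low lam v i.
Proof.
by move=> ik hi f; rewrite /low history_tree //; apply: eq_bigr => u _; exact: history_arr.
Qed.

Lemma history_bdry i : history i -> bdry lam' v i = bdry lam v i.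
Proof. by move=> hi; rewrite /bdry history_tree. Qed.

Lemma history_resample :
  history k <->
  forall f, f \in bdry lam v k -> (lam' f < low lam v k f) || (Yseq E lam v k < lam' f).
Proof.
split=> [hk f fS|H].
  case: ltP => //= lf; rewrite -history_Yseq //; apply: bdry_label => //.
    by rewrite history_bdry.
  by rewrite history_low.
suff: forall i, (i <= k)%N -> history i by apply.
elim=> [//|i IH] ik; have hi := IH (ltnW ik).
have iV : (i.+1 < #|V|)%N by apply: leq_ltn_trans kn.
have [nS nl nmin] := next_spec v lam_gt0 iV.
have ln : lam' (new_edge lam v i) = lam (new_edge lam v i).
  by apply: agree; [exact: next_bdry_edge|exact: next_notin_bdry].
move=> j; rewrite ltnS leq_eqVlt => /orP[/eqP ->|]; last exact: hi.
apply: next_uniq => //; rewrite ?history_bdry // ?history_low ?ln //; first exact: ltnW.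
move=> f fS; rewrite history_low ?(ltnW ik) // => fl.
have [fk|fk] := boolP (f \in bdry lam v k); last first.
  by move: fl; rewrite agree ?(bdry_edge fS) // => fl; apply: nmin.
have lowk : low lam v k f <= lam' f.
  suff -> : low lam v k f = low lam v i f by [].
  case/bdryP: fk fS => u [w [uT wT ->]] fS.
  have wi : w \notin vset (tree lam v i).
    by apply: contra wT; apply/fintype.subsetP/tree_sub/ltnW.
  have ui : u \in vset (tree lam v i).
    case/bdryP: fS => u' [w' [ui wi' /setP/(_ u')]]; rewrite !inE eqxx /=.
    by case: (eqVneq u' u) => [<- //|_] /= /eqP e; rewrite e (negPf wi) in ui.
  rewrite !lowE //; move: (ltnW ik); clear -ui.
  elim: k => [|m IH]; first by rewrite leqn0 => /eqP ->.
  rewrite leq_eqVlt => /orP[/eqP -> //|im]; rewrite -(IH im) /=.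
  by rewrite (fintype.subsetP (tree_sub lam v (im : (i <= m)%N)) _ ui).
have := H _ fk; case: ltP lowk => //= _ _ lt.
apply: le_trans (ltW lt); rewrite -YseqS; exact: Yseq_le.
Qed.
End Resample.
End Exploration.

(** * The grid model *)

Lemma card_ord_ge M t : #|[pred i : 'I_M | (t <= i)%N]| = (M - t)%N.
Proof.
rewrite -sum1_card.
transitivity (\sum_(0 <= i < M | (t <= i)%N) 1)%N; first by rewrite big_mkord.
have := @big_nat_widenl _ 0%N addn t 0 M predT (fun=> 1%N) (leq0n t).
rewrite sum_nat_const_nat muln1 => ->; exact: eq_bigl.
Qed.

Section Thresholds.
Variable R : realType.

(* The labels above a threshold [z] form a final segment, which moving the
   threshold by the integer [j] shifts by [j]. *)
Lemma threshold (z r : R) : 0 <= z -> 0 < r < 1 ->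
  exists t : nat, [/\ t%:R <= z + 1,
    forall i : nat, (z < i%:R + r) = (t <= i)%N &
    forall i j : nat, (z + j%:R < i%:R + r) = (t + j <= i)%N].
Proof.
move=> z0 /andP[r0 r1].
have ex : exists i : nat, z < i%:R + r.
  by exists (Num.truncn z).+1; have := truncnS_gt z; lra.
case: (ex_minnP ex) => t tP tmin; exists t.
have tE i : (z < i%:R + r) = (t <= i)%N.
  apply/idP/idP => [/tmin //|ti]; apply: lt_le_trans tP _.
  by rewrite lerD2r ler_nat.
split=> // [|i j].
  case: t tP tmin tE => [|t] _ tmin _; first by lra.
  rewrite -natr1 lerD2r leNgt; apply/negP => zt.
  have : z < t%:R + r by lra.
  by move/tmin; rewrite ltnn.
have [ji|ij] := leqP j i.
  by rewrite addnC -leq_subRL // -tE natrB //; apply/idP/idP; lra.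
have ij' : i%:R + 1 <= j%:R :> R by rewrite natr1 ler_nat.
have -> : (t + j <= i)%N = false by apply/negbTE; rewrite -ltnNge ltn_addl.
by apply/negbTE; rewrite -leNgt; lra.
Qed.
End Thresholds.

Section FiniteModel.
Variables (V : finType) (R : realType) (N : nat) (v : V).
Local Notation M := N.+1.

Definition edge := {e : {set V} | e \in complete_edges V}.
Definition config := {ffun edge -> 'I_N.+1}.

(* Distinct offsets in ]0, 1[ separate edges with the same grid label, so that
   every configuration has distinct positive labels. *)
Definition offset (e : edge) : R := (enum_rank e).+1%:R / #|{: edge}|.+1%:R.

Definition label (g : config) (e : {set V}) : R :=
  if insub e is Some i then ((g i)%:R + offset i) / N.+1%:R else 0.

Lemma offset_bounds e : 0 < offset e < 1.
Proof.
by rewrite /offset divr_gt0 ?ltr0n //= ltr_pdivrMr ?ltr0n // mul1r ltr_nat ltnS ltn_ord.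
Qed.

Lemma offset_inj : injective offset.
Proof.
move=> e f /(mulIf (invr_neq0 (lt0r_neq0 (ltr0Sn R #|{: edge}|))))/eqP.
by rewrite eqr_nat eqSS => /eqP ef; apply: enum_rank_inj; apply: val_inj.
Qed.

Lemma label_val g (e : edge) : label g (val e) = ((g e)%:R + offset e) / M%:R.
Proof. by rewrite /label valK. Qed.

Lemma label_gt0 g e : e \in complete_edges V -> 0 < label g e.
Proof.
move=> eE; rewrite -[e]/(val (exist _ e eE : edge)) label_val.
have /andP[p0 _] := offset_bounds (exist _ e eE).
by rewrite divr_gt0 ?ltr0n // ltr_wpDl.
Qed.

Lemma label_inj g : {in complete_edges V &, injective (label g)}.
Proof.
move=> e f eE fE; rewrite -[e]/(val (exist _ e eE : edge)) -[f]/(val (exist _ f fE : edge)).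
move: (exist _ e eE : edge) (exist _ f fE : edge) => {eE fE}e {}f.
rewrite !label_val => /(mulIf (invr_neq0 (lt0r_neq0 (ltr0Sn _ _)))) ef.
have no (a b x y : R) : 0 < x < 1 -> 0 < y < 1 -> a + x = b + y -> ~ (a + 1 <= b).
  by move=> ? ? ? ?; lra.
have gg : g e = g f.
  apply: val_inj => /=; apply/eqP; rewrite eqn_leq (leqNgt (g e)) (leqNgt (g f)).
  apply/andP; split; apply/negP; rewrite -(ler_nat R) -natr1.
    exact: no (offset_bounds f) (offset_bounds e) (esym ef).
  exact: no (offset_bounds e) (offset_bounds f) ef.
by congr val; apply: offset_inj; move: ef; rewrite gg => /addrI.
Qed.

Local Notation Y g := (Yseq (complete_edges V) (label g) v).
Local Notation X g := (Xseq (complete_edges V) (label g) v).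

(* Configurations with the same key share their first [k] tree edges and all
   labels off the boundary; such a class is a product of sets of labels. *)
Definition key k (g : config) : {ffun 'I_k -> {set V}} * config :=
  ([ffun i : 'I_k => new_edge (label g) v i],
   [ffun e => if val e \in bdry (label g) v k then ord0 else g e]).

Section Fiber.
Variables (k : nat) (g0 : config).
Hypothesis kV : (k.+1 < #|V|)%N.
Let kV' : (k < #|V|)%N. Proof. exact: ltnW. Qed.
Local Notation S := (bdry (label g0) v k).
Local Notation lo := (low (label g0) v k).

Definition box (y : R) (e : edge) : pred 'I_N.+1 := fun i =>
  if val e \in S then (((i%:R + offset e) / M%:R < lo (val e)) || (y < (i%:R + offset e) / M%:R))
  else i == g0 e.

Lemma key_history g : key k g = key k g0 ->
  [/\ forall i, (i < k)%N -> new_edge (label g) v i = new_edge (label g0) v i &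
      forall e, e \in complete_edges V -> e \notin S -> label g e = label g0 e].
Proof.
move=> [/ffunP kg /ffunP kb].
have hist i : (i < k)%N -> new_edge (label g) v i = new_edge (label g0) v i.
  by move=> ik; have := kg (Ordinal ik); rewrite !ffunE.
split=> // e eE; rewrite -[e]/(val (exist _ e eE : edge)).
move: (exist _ e eE : edge) => {eE}e eS; rewrite !label_val.
have := kb e; rewrite !ffunE (history_bdry (lam := label g0) (lam' := label g) hist).
by rewrite (negPf eS) => ->.
Qed.

Lemma keyP g : reflect (key k g = key k g0) (g \in family (box (Y g0 k))).
Proof.
have agreeE : (forall e : edge, val e \notin S -> g e = g0 e) ->
    forall e, e \in complete_edges V -> e \notin S -> label g e = label g0 e.
  move=> H e eE; rewrite -[e]/(val (exist _ e eE : edge)) => eS.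
  by rewrite !label_val H.
have HR := @history_resample _ _ _ _ v _ (label_gt0 g0) (label_gt0 g)
  (@label_inj g0) (@label_inj g) kV'.
apply: (iffP familyP) => [H|/[dup] gk /key_history[hist agr] e].
  have agr : forall e : edge, val e \notin S -> g e = g0 e.
    by move=> e eS; have := H e; rewrite unfold_in /box (negPf eS) => /eqP.
  have hist : forall i, (i < k)%N -> new_edge (label g) v i = new_edge (label g0) v i.
    apply/(HR (agreeE agr)) => f fS; have fE := bdry_edge fS.
    have := H (exist _ f fE); rewrite unfold_in /box /= fS.
    by rewrite -(label_val g (exist _ f fE)).
  congr pair; apply/ffunP => i; rewrite !ffunE ?hist //.
  rewrite (history_bdry (lam := label g0) (lam' := label g) hist).
  by case: ifPn => // /agr.
rewrite unfold_in /box; case: ifPn => eS; last first.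
  case: gk => _ /ffunP/(_ e); rewrite !ffunE.
  by rewrite (history_bdry (lam := label g0) (lam' := label g) hist) (negPf eS) => ->.
by have /(_ hist _ eS) := (HR agr).1; rewrite label_val.
Qed.

Lemma key_Yseq g i : (i <= k)%N -> key k g = key k g0 -> Y g i = Y g0 i.
Proof.
move=> ik /key_history[hist agr].
apply: (history_Yseq (label_gt0 g0) kV' agr ik) => j ji.
by apply: hist; exact: leq_trans ik.
Qed.

Lemma Xseq_gt_family g (j : nat) :
  (key k g == key k g0) && (j%:R / M%:R < X g k.+1) = (g \in family (box (Y g0 k + j%:R / M%:R))).
Proof.
have j0 : 0 <= j%:R / M%:R :> R by rewrite divr_ge0.
apply/andP/familyP => [[/eqP gk]|H].
  have [hist agr] := key_history gk.
  rewrite Xseq_gt //; [|exact: label_gt0] => /'forall_implyP H e.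
  have := familyP (introT (keyP g) gk) e; rewrite !unfold_in /box.
  case: ifPn => // eS _; have := H (val e).
  rewrite (history_bdry (lam := label g0) (lam' := label g) hist) => /(_ eS).
  rewrite (history_low (label_gt0 g0) kV' agr (leqnn k) hist).
  by rewrite (key_Yseq (leqnn k) gk) label_val.
have gk : key k g = key k g0.
  apply/keyP/familyP => e; have := H e; rewrite !unfold_in /box; case: ifP => // _.
  by case/orP => [-> //|lt]; apply/orP; right; apply: le_lt_trans lt; rewrite lerDl.
have [hist agr] := key_history gk.
rewrite gk eqxx; split=> //; rewrite Xseq_gt //; [|exact: label_gt0].
apply/'forall_implyP => f; rewrite (history_bdry (lam := label g0) (lam' := label g) hist) => fS.
have fE := bdry_edge fS; have := H (exist _ f fE); rewrite unfold_in /box /= fS.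
rewrite -(label_val g (exist _ f fE)) /=.
rewrite (history_low (label_gt0 g0) kV' agr (leqnn k) hist).
by rewrite (key_Yseq (leqnn k) gk).
Qed.

End Fiber.
End FiniteModel.

Section Tails.
Variables (V : finType) (R : realType) (N : nat) (v : V).
Local Notation M := N.+1.
Local Notation config := (config V N).
Local Notation edge := (edge V).
Local Notation Y g := (Yseq (complete_edges V) (label R g) v).
Local Notation Xg g := (Xseq (complete_edges V) (label R g) v).

Section Fiber.
Variables (k : nat) (g0 : config).
Hypothesis kV : (k.+1 < #|V|)%N.
Let kV' : (k < #|V|)%N. Proof. exact: ltnW. Qed.
Local Notation S := (bdry (label R g0) v k).
Local Notation lo := (low (label R g0) v k).
Local Notation B := (@box V R N v k g0).
Local Notation y := (Y g0 k).

Let M0 : 0 < M%:R :> R. Proof. by rewrite ltr0n. Qed.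

Let y0 : 0 <= y.
Proof.
exact: (Yseq_le v (label_gt0 R g0) (@label_inj V R N g0) (leq0n k) kV').
Qed.

Lemma card_box_bdry (e : edge) : val e \in S ->
  exists t p : nat, [/\ t%:R <= M%:R * y + 1, M%:R * y < t%:R + 1, lo (val e) = 0 -> p = 0%N,
    (p + (M - t) <= M)%N &
    forall j : nat, #|B (y + j%:R / M%:R) e| = (p + (M - (t + j)))%N].
Proof.
move=> eS; have z0 : 0 <= M%:R * y by rewrite mulr_ge0 // ltW.
have [t [tz tE tjE]] := threshold z0 (offset_bounds R e).
pose p := #|[pred i : 'I_M | (i%:R + offset R e) / M%:R < lo (val e)]|.
have cardB j : #|B (y + j%:R / M%:R) e| = (p + (M - (t + j)))%N.
  rewrite -card_ord_ge -cardUI [X in (_ + X)%N]eq_card0 ?addn0; last first.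
    move=> i; rewrite !inE; apply/negP => /andP[lt].
    rewrite -tjE => gt; have /andP[_ ly] := low_le (label_gt0 R g0) (@label_inj V R N g0) kV' eS.
    have : (i%:R + offset R e) / M%:R < y by apply: lt_le_trans lt ly.
    rewrite ltr_pdivrMr // mulrC => lt'.
    have : 0 <= j%:R :> R by [].
    by move: gt lt'; set a := _ * y; set b := _ + offset R e; lra.
  apply: eq_card => i; rewrite [LHS]unfold_in /box eS !inE; congr orb.
  rewrite -tjE ltr_pdivlMr // mulrDl divfK ?lt0r_neq0 //.
  by rewrite [y * _]mulrC.
exists t, p; split=> //.
- have := tE t; rewrite leqnn => lt; apply: lt_trans lt _.
  by rewrite ltrD2l; have /andP[] := offset_bounds R e.
- move=> l0; apply: eq_card0 => i; rewrite inE l0; apply/negbTE; rewrite -leNgt.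
  by rewrite divr_ge0 // addr_ge0 // ltW //; have /andP[] := offset_bounds R e.
- have := cardB 0%N; rewrite addn0 => <-.
  by apply: leq_trans (max_card _) _; rewrite card_ord.
Qed.

Lemma card_box_nbdry (e : edge) z : val e \notin S -> #|B z e| = 1%N.
Proof.
move=> eS; rewrite -(card1 (g0 e)); apply: eq_card => i.
by rewrite [LHS]unfold_in /box (negPf eS) inE.
Qed.

Lemma card_family_prod (F : edge -> pred 'I_M) :
  #|family F|%:R = \prod_e #|F e|%:R :> R.
Proof. by rewrite card_family foldrE big_map big_enum /= natr_prod. Qed.

Lemma prod_bdry (x : R) :
  \prod_(e : edge) (if val e \in S then x else 1) = x ^+ (k.+1 * (#|V| - k.+1)).
Proof.
rewrite -big_mkcond /= prodr_const -(card_bdry v (label_gt0 R g0) kV'); congr (_ ^+ _).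
rewrite -(card_imset _ val_inj); apply: eq_card => f; apply/imsetP/idP => [[e eS ->] //|fS].
by exists (exist _ f (bdry_edge fS)).
Qed.

Lemma fiber_upper (j : nat) : (j <= M)%N ->
  #|family (B (y + j%:R / M%:R))|%:R <=
  (1 - j%:R / M%:R) ^+ (k.+1 * (#|V| - k.+1)) * #|family (B y)|%:R :> R.
Proof.
move=> jM; have jM' : 0 <= 1 - j%:R / M%:R :> R.
  by rewrite subr_ge0 ler_pdivrMr // mul1r ler_nat.
have card0 (e : edge) : #|B y e| = #|B (y + 0%:R / M%:R) e| by rewrite mul0r addr0.
have [small|] := boolP [forall e : edge, (val e \in S) ==>
    (j <= #|B (y + 0%:R / M%:R) e| - #|B (y + j%:R / M%:R) e|)%N].
  rewrite !card_family_prod -prod_bdry -big_split /=; apply: ler_prod => e _.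
  rewrite ler0n /=; case: ifPn => eS; last first.
    by rewrite !card_box_nbdry // mulr1.
  have := forallP small e; rewrite eS /= card0.
  have [t [p [_ _ _ pM cB]]] := card_box_bdry eS; rewrite !cB addn0 => jle.
  set b := (p + (M - t))%N in pM jle *; set c := (p + (M - (t + j)))%N in jle *.
  have cb : c%:R + j%:R <= b%:R :> R by rewrite -natrD ler_nat; lia.
  have bM : b%:R <= M%:R :> R by rewrite ler_nat.
  have : j%:R / M%:R * b%:R <= j%:R :> R.
    by rewrite mulrAC ler_pdivrMr // ler_wpM2l.
  move: cb bM; set x := _ / _; rewrite mulrBl mul1r; move: (M%:R : R) => q; lra.
move=> /forallPn[e]; rewrite negb_imply => /andP[eS].
have [t [p [tle _ _ _ cB]]] := card_box_bdry eS; rewrite !cB addn0 => big.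
have Mt : (M < t + j)%N by lia.
have [f fS lf] := root_edge (exploredP v (label_gt0 R g0) kV') kV.
have [t' [p' [_ tlt' p0 _ cB']]] := card_box_bdry (e := exist _ f (bdry_edge fS)) fS.
suff zero : #|B (y + j%:R / M%:R) (exist _ f (bdry_edge fS))| = 0%N.
  rewrite card_family_prod (bigD1 (exist _ f (bdry_edge fS))) //= zero mul0r.
  by rewrite mulr_ge0 // exprn_ge0.
rewrite cB' p0 // add0n; apply/eqP; rewrite subn_eq0.
suff : (t < t'.+2)%N by lia.
rewrite -(ltr_nat R) -addn2 natrD.
by move: tle tlt'; set a := _ * y; lra.
Qed.

Lemma fiber_lower (j : nat) (q : R) : 0 < q -> j%:R <= q -> M%:R * y + 1 + q <= M%:R ->
  (1 - j%:R / q) ^+ (k.+1 * (#|V| - k.+1)) * #|family (B y)|%:R <=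
  #|family (B (y + j%:R / M%:R))|%:R :> R.
Proof.
move=> q0 jq yq.
have jq' : 0 <= 1 - j%:R / q by rewrite subr_ge0 ler_pdivrMr // mul1r.
have card0 (e : edge) : #|B y e| = #|B (y + 0%:R / M%:R) e| by rewrite mul0r addr0.
rewrite !card_family_prod -prod_bdry -big_split /=; apply: ler_prod => e _.
rewrite mulr_ge0 //=; last by case: ifP.
case: ifPn => eS; last by rewrite !card_box_nbdry // mulr1.
rewrite card0; have [t [p [tle _ _ pM cB]]] := card_box_bdry eS; rewrite !cB addn0.
have tj : t%:R + j%:R <= M%:R :> R by move: tle yq jq; set a := _ * y; set m := M%:R; lra.
have tjM : (t + j <= M)%N by rewrite -(ler_nat R) natrD.
have tM : (t <= M)%N by apply: leq_trans tjM; rewrite leq_addr.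
rewrite !natrD natrB // (natrB R tjM) natrD mulrBl mul1r.
have : j%:R <= j%:R / q * (p%:R + (M%:R - t%:R)).
  rewrite mulrAC ler_pdivlMr // ler_wpM2l //.
  have : 0 <= p%:R :> R by [].
  by move: tle yq; set a := _ * y; set m := M%:R; lra.
set c := _ / q * _; move: (M%:R : R) => m; lra.
Qed.

End Fiber.
End Tails.

(** * Tails and conditional means *)

Section LayerCake.
Variable R : realType.
Implicit Types (z a b q : R).

Lemma layer_upper z M : z <= M%:R -> z <= \sum_(0 <= j < M) ((j%:R : R) < z)%R%:R.
Proof.
elim: M => [|M IH] zM; first by rewrite big_geq.
rewrite big_nat_recr //=; case: ltP => [lt|ge]; last by rewrite addr0 IH.
apply: le_trans zM _; rewrite -natr1 lerD2r.
rewrite (eq_big_nat _ _ (F2 := fun=> 1)) => [|j /andP[_ jM]].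
  by rewrite sumr_const_nat subn0.
by rewrite (lt_trans _ lt) // ltr_nat.
Qed.

Lemma layer_lower z J : 0 <= z ->
  \sum_(1 <= j < J.+1) ((j%:R : R) < z)%R%:R <= Num.min z J%:R.
Proof.
have const n : \sum_(1 <= j < n.+1) ((j%:R : R) < z)%R%:R <= n%:R :> R.
  rewrite (le_trans (y := \sum_(1 <= j < n.+1) 1)) //.
    by apply: ler_sum => j _; case: (_ < _).
  by rewrite sumr_const_nat subn1.
move=> z0; rewrite le_min const andbT.
elim: J => [|J IH]; first by rewrite big_geq.
rewrite big_nat_recr //=; case: ltP => [lt|ge]; last by rewrite addr0.
by rewrite (le_trans _ (ltW lt)) // -natr1 lerD2r.
Qed.

Lemma exp_diff_ge m a b : 0 <= b -> b <= a ->
  (a - b) * m.+1%:R * b ^+ m <= a ^+ m.+1 - b ^+ m.+1.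
Proof.
move=> b0 ba; elim: m => [|m IH]; first by rewrite !expr1 expr0 !mulr1.
have -> : a ^+ m.+2 - b ^+ m.+2 = a * (a ^+ m.+1 - b ^+ m.+1) + (a - b) * b ^+ m.+1.
  by rewrite [a ^+ _]exprS [b ^+ m.+2]exprS; ring.
have h : 0 <= a ^+ m.+1 - b ^+ m.+1.
  by rewrite subr_ge0 lerXn2r // nnegrE // (le_trans b0).
have : b * ((a - b) * m.+1%:R * b ^+ m) <= a * (a ^+ m.+1 - b ^+ m.+1).
  apply: le_trans (ler_wpM2l b0 IH) _; exact: ler_wpM2r.
by rewrite -[m.+2%:R]natr1 [b ^+ m.+1]exprS; set c := m.+1%:R; set d := b ^+ m; lra.
Qed.

Lemma exp_diff_le m a b : 0 <= b -> b <= a ->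
  a ^+ m.+1 - b ^+ m.+1 <= (a - b) * m.+1%:R * a ^+ m.
Proof.
move=> b0 ba; have a0 := le_trans b0 ba.
elim: m => [|m IH]; first by rewrite !expr1 expr0 !mulr1.
have -> : a ^+ m.+2 - b ^+ m.+2 = a * (a ^+ m.+1 - b ^+ m.+1) + (a - b) * b ^+ m.+1.
  by rewrite [a ^+ _]exprS [b ^+ m.+2]exprS; ring.
have h : (a - b) * b ^+ m.+1 <= (a - b) * a ^+ m.+1.
  by rewrite ler_wpM2l ?subr_ge0 // lerXn2r // nnegrE.
have := ler_wpM2l a0 IH; move: h.
by rewrite -[m.+2%:R]natr1 [a ^+ m.+1]exprS; set c := m.+1%:R; set d := a ^+ m; lra.
Qed.

Lemma expR_opp_ge (x : R) : 1 - x <= expR (- x) :> R.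
Proof. by have := expR_ge1Dx (- x). Qed.

Lemma exp_le_expR x m : x <= 1 -> (1 - x) ^+ m <= expR (- (x * m%:R)) :> R.
Proof.
move=> x1; rewrite -mulNr mulrC expRM_natl lerXn2r ?nnegrE ?expR_ge0 ?subr_ge0 //.
exact: expR_opp_ge.
Qed.

Lemma riemann_upper m M : 
  \sum_(0 <= j < M.+1) (1 - j%:R / M.+1%:R) ^+ m <= M.+1%:R / m.+1%:R + 1 :> R.
Proof.
have M0 : 0 < M.+1%:R :> R by rewrite ltr0n.
rewrite big_nat_recl //= mul0r subr0 expr1n addrC lerD2r ler_pdivlMr ?ltr0n //.
rewrite mulrC -[leRHS]mulr1 -ler_pdivrMl //.
suff H n : (n <= M)%N -> M.+1%:R^-1 * (m.+1%:R * \sum_(0 <= j < n) (1 - j.+1%:R / M.+1%:R) ^+ m)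
  <= 1 - (1 - n%:R / M.+1%:R) ^+ m.+1 :> R.
  apply: le_trans (H M (leqnn _)) _; rewrite gerBl.
  by rewrite exprn_ge0 // subr_ge0 ler_pdivrMr // mul1r ler_nat leqnSn.
elim: n => [|n IH] nM; first by rewrite big_geq // !mulr0 mul0r subr0 expr1n subrr.
rewrite big_nat_recr //= !mulrDr; apply: le_trans (lerD (IH (ltnW nM)) (lexx _)) _.
have b0 : 0 <= 1 - n.+1%:R / M.+1%:R :> R.
  by rewrite subr_ge0 ler_pdivrMr // mul1r ler_nat; apply: leqW.
have := @exp_diff_ge m (1 - n%:R / M.+1%:R) (1 - n.+1%:R / M.+1%:R) b0.
rewrite lerD2l lerN2 ler_pM2r ?invr_gt0 // ler_nat leqnSn => /(_ isT).
have -> : 1 - n%:R / M.+1%:R - (1 - n.+1%:R / M.+1%:R) = M.+1%:R^-1 :> R.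
  by rewrite -[n.+1%:R]natr1; ring.
by rewrite mulrA; set c := _ * _ ^+ m; lra.
Qed.

Lemma riemann_lower m J q : 0 < q -> J.+1%:R <= q ->
  q / m.+1%:R * (1 - m.+1%:R / q - (1 - J.+1%:R / q) ^+ m.+1)
   <= \sum_(1 <= j < J.+1) (1 - j%:R / q) ^+ m.
Proof.
move=> q0 Jq; rewrite -ler_pdivlMl ?divr_gt0 // invf_div.
suff H n : (n <= J)%N -> (1 - 1%:R / q) ^+ m.+1 - (1 - n.+1%:R / q) ^+ m.+1 <=
   m.+1%:R / q * \sum_(1 <= j < n.+1) (1 - j%:R / q) ^+ m.
  apply: le_trans (H J (leqnn _)); rewrite lerD2r.
  have h : 0 <= 1 - 1%:R / q.
    by rewrite subr_ge0 ler_pdivrMr // mul1r (le_trans _ Jq) // ler_nat.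
  have := @exp_diff_le m 1 _ h; rewrite gerBl divr_ge0 ?(ltW q0) // => /(_ isT).
  by rewrite !expr1n subKr mulr1 mul1r mulrC; set c := _ / q; lra.
elim: n => [|n IH] nJ; first by rewrite big_geq // mulr0 subrr.
rewrite big_nat_recr //= mulrDr; apply: le_trans (lerD (IH (ltnW nJ)) (lexx _)).
have b0 : 0 <= 1 - n.+2%:R / q.
  by rewrite subr_ge0 ler_pdivrMr // mul1r (le_trans _ Jq) // ler_nat.
have := @exp_diff_le m (1 - n.+1%:R / q) (1 - n.+2%:R / q) b0.
rewrite lerD2l lerN2 ler_pM2r ?invr_gt0 // ler_nat leqnSn => /(_ isT).
have -> : 1 - n.+1%:R / q - (1 - n.+2%:R / q) = q^-1.
  by rewrite -[n.+2%:R]natr1; field; rewrite lt0r_neq0.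
by rewrite [q^-1 * _]mulrC; set c := _ / q * _; lra.
Qed.

End LayerCake.

Section Means.
Variables (V : finType) (R : realType) (N : nat) (v : V).
Local Notation M := N.+1.
Local Notation config := (config V N).
Local Notation Y g := (Yseq (complete_edges V) (label R g) v).
Local Notation Xg g := (Xseq (complete_edges V) (label R g) v).

Lemma label_le1 (g : config) e : e \in complete_edges V -> label R g e <= 1.
Proof.
move=> eE; rewrite -[e]/(val (exist _ e eE : edge V)) label_val.
rewrite ler_pdivrMr ?ltr0n // mul1r.
have /andP[_ r1] := offset_bounds R (exist _ e eE : edge V).
set i := g _; have : i%:R + 1 <= M%:R :> R by rewrite natr1 ler_nat.
by move: r1; set r := offset _ _; move: (M%:R : R) (i%:R : R) => a b; lra.
Qed.

Section Step.
Variables (k : nat) (W : config -> R).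
Hypothesis kV : (k.+1 < #|V|)%N.
Hypothesis W0 : forall g, 0 <= W g.
Hypothesis Wkey : forall g g', key R v k g = key R v k g' -> W g = W g'.
Local Notation m := (k.+1 * (#|V| - k.+1))%N.
Let kV' : (k < #|V|)%N. Proof. exact: ltnW. Qed.

Let M0 : 0 < M%:R :> R. Proof. by rewrite ltr0n. Qed.

Lemma sum_fiber g0 (j : nat) :
  \sum_(g | key R v k g == key R v k g0) W g * (j%:R / M%:R < Xg g k.+1)%R%:R =
  W g0 * #|family (box v k g0 (Y g0 k + j%:R / M%:R))|%:R.
Proof.
rewrite (eq_bigr (fun g => W g0 * (j%:R / M%:R < Xg g k.+1)%R%:R)); last first.
  by move=> g /eqP/Wkey ->.
rewrite -mulr_sumr -natr_sum; congr (_ * _%:R).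
rewrite -sum1_card [LHS]big_mkcond [RHS]big_mkcond; apply: eq_bigr => g _.
by rewrite -Xseq_gt_family //; case: eqP => //= _; case: (_ < _).
Qed.

Lemma sum_fiber_all g0 :
  \sum_(g | key R v k g == key R v k g0) W g = W g0 * #|family (box v k g0 (Y g0 k))|%:R.
Proof.
rewrite (eq_bigr (fun g => W g0 * 1)); last by move=> g /eqP/Wkey ->; rewrite mulr1.
rewrite -mulr_sumr sumr_const; congr (_ * _%:R).
by apply: eq_card => g; rewrite [LHS]unfold_in; exact: sameP eqP (keyP R v g0 kV g).
Qed.

Lemma key_sum_le (F G : config -> R) :
  (forall g0, \sum_(g | key R v k g == key R v k g0) F g <=
              \sum_(g | key R v k g == key R v k g0) G g) ->
  \sum_g F g <= \sum_g G g.
Proof.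
move=> H; rewrite (partition_big (key R v k) predT) //=.
rewrite [leRHS](partition_big (key R v k) predT) //=; apply: ler_sum => c _.
have [/existsP[g0 /eqP <-]|/existsPn no] := boolP [exists g, key R v k g == c]; first exact: H.
by rewrite !big_pred0 // => g; apply/negbTE/no.
Qed.

Lemma tail_upper (j : nat) : (j <= M)%N ->
  \sum_(g : config) W g * (j%:R / M%:R < Xg g k.+1)%R%:R <= (1 - j%:R / M%:R) ^+ m * \sum_(g : config) W g.
Proof.
move=> jM; rewrite mulr_sumr; apply: key_sum_le => g0; rewrite -mulr_sumr.
rewrite sum_fiber sum_fiber_all mulrCA ler_wpM2l //; exact: fiber_upper.
Qed.

Lemma tail_lower (j : nat) q : 0 < q -> j%:R <= q ->
  (forall g, W g != 0 -> M%:R * Y g k + 1 + q <= M%:R) ->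
  (1 - j%:R / q) ^+ m * \sum_(g : config) W g <= \sum_(g : config) W g * (j%:R / M%:R < Xg g k.+1)%R%:R.
Proof.
move=> q0 jq Wq; rewrite mulr_sumr; apply: key_sum_le => g0; rewrite -mulr_sumr.
rewrite sum_fiber sum_fiber_all mulrCA; have [->|/Wq Y0] := eqVneq (W g0) 0.
  by rewrite !mul0r.
by rewrite ler_wpM2l // fiber_lower.
Qed.

Lemma Xseq_bounds (g : config) : 0 <= Xg g k.+1 <= 1.
Proof.
have lt := Yseq_lt v (label_gt0 R g) (@label_inj V R N g) kV.
have Y0 := Yseq_le v (label_gt0 R g) (@label_inj V R N g) (leq0n k) kV'.
rewrite /Xseq /= subr_ge0 (ltW lt) /=.
suff : Y g k.+1 <= 1 by move: Y0; rewrite /= -/(Yseq _ _ _ _); lra.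
rewrite YseqS; apply: label_le1; by apply: next_bdry_edge; [exact: label_gt0|exact: kV].
Qed.

Lemma mean_upper c :
  \sum_(g : config) W g * Num.min (Xg g k.+1) c <= (m.+1%:R^-1 + M%:R^-1) * \sum_(g : config) W g.
Proof.
apply: (@le_trans _ _ (\sum_(g : config) W g * (M%:R^-1 * \sum_(0 <= j < M) (j%:R / M%:R < Xg g k.+1)%R%:R))).
  apply: ler_sum => g _; apply: ler_wpM2l => //.
  rewrite (le_trans (y := Xg g k.+1)) ?ge_min ?lexx //.
  rewrite ler_pdivlMl //; have /andP[_ x1] := Xseq_bounds g.
  apply: le_trans (layer_upper (M := M) _) _; first by rewrite ler_piMr // ltW.
  by apply: ler_sum => j _; rewrite ltr_pdivrMr // [_ * M%:R]mulrC.
under eq_bigr do rewrite mulrCA mulr_sumr; rewrite -mulr_sumr exchange_big /=.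
rewrite ler_pdivrMl //.
apply: (@le_trans _ _ (\sum_(0 <= j < M) (1 - j%:R / M%:R) ^+ m * \sum_(g : config) W g)).
  by apply: ler_sum_nat => j /andP[_ jM]; apply: tail_upper; exact: ltnW.
rewrite -mulr_suml mulrA ler_wpM2r ?sumr_ge0 //.
by apply: le_trans (riemann_upper _ _ _) _; rewrite mulrDr mulfV ?lt0r_neq0.
Qed.

Lemma mean_lower c eta : 0 <= c <= 4^-1 -> 0 < eta <= 4^-1 -> 2 * m.+1%:R <= eta * M%:R ->
  (forall g, W g != 0 -> Y g k <= eta) ->
  (1 - 3 * eta - expR (- (c * m%:R))) / m.+1%:R * \sum_(g : config) W g <=
  \sum_(g : config) W g * Num.min (Xg g k.+1) c.
Proof.
move=> /andP[c0 c1] /andP[e0 e1] mM WY.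
have m2 : 1 <= m%:R :> R by rewrite ler1n muln_gt0 /= subn_gt0.
have mS : m.+1%:R = m%:R + 1 :> R by rewrite natr1.
have eM : eta * M%:R <= 4^-1 * M%:R by rewrite ler_wpM2r // ltW.
have cM : c * M%:R <= 4^-1 * M%:R by rewrite ler_wpM2r // ltW.
pose q := M%:R * (1 - 2 * eta).
have qE : q = M%:R - 2 * (eta * M%:R) by rewrite /q; ring.
have q0 : 0 < q by move: mM eM; rewrite qE mS; lra.
pose J := Num.truncn (c * M%:R).
have J1 : J%:R <= c * M%:R by rewrite truncn_le // mulr_ge0 // ltW.
have J2 : c * M%:R < J.+1%:R by exact: truncnS_gt.
have Jq : J.+1%:R <= q.
  by rewrite -natr1; move: mM eM cM J1; rewrite qE mS; lra.
apply: (@le_trans _ _ (\sum_(g : config) W g * (M%:R^-1 * \sum_(1 <= j < J.+1) (j%:R / M%:R < Xg g k.+1)%R%:R))); last first.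
  apply: ler_sum => g _; apply: ler_wpM2l => //.
  have /andP[x0 _] := Xseq_bounds g.
  rewrite ler_pdivrMl //.
  rewrite (eq_bigr (fun j : nat => ((j%:R : R) < M%:R * Xg g k.+1)%R%:R)); last first.
    by move=> j _; rewrite ltr_pdivrMr // [_ * M%:R]mulrC.
  apply: le_trans (layer_lower _ _) _; first by rewrite mulr_ge0 // ltW.
  rewrite minr_pMr ?(ltW M0) // le_min ge_min lexx /=.
  by rewrite ge_min [M%:R * c]mulrC J1 orbT.
under [leRHS]eq_bigr do rewrite mulrCA mulr_sumr.
rewrite -[leRHS]mulr_sumr [X in _ <= _ * X]exchange_big /=.
rewrite ler_pdivlMl //.
apply: (@le_trans _ _ (\sum_(1 <= j < J.+1) (1 - j%:R / q) ^+ m * \sum_(g : config) W g)); last first.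
  apply: ler_sum_nat => j /andP[_ jJ]; apply: tail_lower => //.
    by apply: le_trans Jq; rewrite ler_nat ltnW.
  move=> g /WY Yg; have := ler_wpM2l (ltW M0) Yg; rewrite [M%:R * eta]mulrC.
  by move: mM; rewrite qE mS; lra.
rewrite -mulr_suml mulrA ler_wpM2r ?sumr_ge0 //.
apply: le_trans (riemann_lower _ q0 Jq).
set ex := expR _; have ex0 : 0 <= ex by apply: expR_ge0.
have exle : (1 - J.+1%:R / q) ^+ m.+1 <= ex.
  apply: le_trans (exp_le_expR _ _) _; first by rewrite ler_pdivrMr // mul1r.
  rewrite ler_expR lerN2 mS; apply: (@le_trans _ _ (c * (m%:R + 1))).
    by rewrite ler_wpM2l // lerDl.
  rewrite ler_wpM2r ?addr_ge0 //.
  rewrite ler_pdivlMr // (le_trans _ (ltW J2)) // ler_wpM2l // qE.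
  by rewrite gerBl mulr_ge0 // mulr_ge0 // ltW.
have mq : m.+1%:R / q <= eta.
  rewrite ler_pdivrMr // qE; have := ler_wpM2l (ltW e0) eM.
  by move: mM; rewrite mS; move: (M%:R : R) (m%:R : R) => a b; lra.
set t := _ ^+ m.+1 in exle *; set s := m.+1%:R / q in mq *.
have -> : M%:R * ((1 - 3 * eta - ex) / m.+1%:R) = M%:R * (1 - 3 * eta - ex) / m.+1%:R.
  by rewrite mulrA.
rewrite [leRHS]mulrAC ler_wpM2r // /q -mulrA ler_wpM2l ?(ltW M0) //.
have : (1 - 2 * eta) * (1 - eta - ex) <= (1 - 2 * eta) * (1 - s - t).
  by rewrite ler_wpM2l //; lra.
have : 0 <= eta * eta by rewrite mulr_ge0 // ltW.
have : 0 <= eta * ex by rewrite mulr_ge0 // ltW.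
lra.
Qed.
End Step.
End Means.

(** * Concentration *)

Section ExponentialMoments.
Variable R : realType.

Lemma expR_le_quadratic (x : R) : x <= 1 -> expR x <= 1 + x + 2 * x ^+ 2.
Proof.
move=> x1; have h : (1 - x / 2) ^+ 2 <= expR (- x).
  rewrite (_ : - x = 2%:R * - (x / 2)); last by field.
  rewrite expRM_natl lerXn2r ?nnegrE ?expR_ge0 //; first by lra.
  exact: expR_opp_ge.
have A0 : 0 <= 1 + x + 2 * x ^+ 2 by have := sqr_ge0 (x + 4^-1); lra.
have A1 : 1 <= (1 + x + 2 * x ^+ 2) * (1 - x / 2) ^+ 2.
  have : 0 <= x ^+ 2 * ((1 - x) * (5 - 2 * x)) by apply: mulr_ge0; [exact: sqr_ge0|apply: mulr_ge0; lra].
  lra.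
have := le_trans A1 (ler_wpM2l A0 h); rewrite expRN => A2.
by rewrite -[leLHS]mul1r -ler_pdivlMr ?expR_gt0.
Qed.

Lemma expR_le_add_sqr (x : R) : expR x <= x + expR (2 * x ^+ 2).
Proof.
have h := expR_ge1Dx (2 * x ^+ 2).
have [x1|x1] := leP x 1; first by have := expR_le_quadratic x1; lra.
suff : expR x <= expR (2 * x ^+ 2) by lra.
by rewrite ler_expR; nra.
Qed.

Lemma norm_sub_le (x y c : R) : 0 <= x <= c -> 0 <= y <= c -> `|x - y| <= c.
Proof.
by move=> /andP[? ?] /andP[? ?]; rewrite ler_norml; apply/andP; split; lra.
Qed.

(* [e^x <= x + e^(2 x^2)] makes the estimate linear in [Z], so that a one-sided
   bound on its (conditional) mean is enough. *)
Lemma mgf_step (I : finType) (W Z : I -> R) (theta C : R) :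
  (forall g, 0 <= W g) -> (forall g, `|Z g| <= C) -> 0 <= theta ->
  \sum_g W g * Z g <= 0 ->
  \sum_g W g * expR (theta * Z g) <= expR (2 * (theta * C) ^+ 2) * \sum_g W g.
Proof.
move=> W0 ZC t0 WZ.
apply: (@le_trans _ _ (theta * \sum_g W g * Z g + expR (2 * (theta * C) ^+ 2) * \sum_g W g)).
  rewrite !mulr_sumr -big_split /=; apply: ler_sum => g _.
  rewrite mulrCA [expR (2 * _) * _]mulrC -mulrDr ler_wpM2l //.
  apply: le_trans (expR_le_add_sqr _) _; rewrite lerD2l ler_expR ler_wpM2l //.
  rewrite !exprMn ler_wpM2l ?sqr_ge0 //.
  by rewrite -[Z g ^+ 2]real_normK ?num_real // lerXn2r // ?nnegrE // (le_trans _ (ZC g)).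
by rewrite gerDr mulr_ge0_le0.
Qed.

Lemma markov_count (I : finType) (P : pred I) (F : I -> R) :
  (forall g, 0 <= F g) -> (forall g, P g -> 1 <= F g) -> #|P|%:R <= \sum_g F g.
Proof.
move=> F0 F1; rewrite -sum1_card natr_sum big_mkcond; apply: ler_sum => g _.
by case: ifP => // /F1.
Qed.

End ExponentialMoments.

Section Deviations.
Variables (V : finType) (R : realType) (N : nat) (v : V).
Local Notation M := N.+1.
Local Notation n := #|V|.
Local Notation config := (config V N).
Local Notation Y g := (Yseq (complete_edges V) (label R g) v).
Local Notation Xg g := (Xseq (complete_edges V) (label R g) v).
Variables (c C : nat -> R) (eta theta : R).
Local Notation hX g i := (Num.min (Xg g i) (c i)).
Local Notation mu i := ((i * (n - i)).+1%:R^-1 : R).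
Local Notation nu i := ((1 - 4 * eta) * (i * (n - i)).+1%:R^-1 : R).

Hypotheses (theta0 : 0 <= theta) (etab : 0 < eta <= 4^-1).
Hypothesis c4 : forall i, (0 < i < n)%N -> 0 <= c i <= 4^-1.
Hypothesis cC : forall i, (0 < i < n)%N -> c i <= C i.
Hypothesis muC : forall i, (0 < i < n)%N -> mu i + M%:R^-1 <= C i.
Hypothesis ceta : forall i, (0 < i < n)%N -> expR (- (c i * (i * (n - i))%:R)) <= eta.
Hypothesis etaM : forall i, (0 < i < n)%N -> 2 * (i * (n - i)).+1%:R <= eta * M%:R.

Lemma key_hX k (g g' : config) : (k.+1 < n)%N -> key R v k g = key R v k g' ->
  forall i, (0 < i <= k)%N -> hX g i = hX g' i.
Proof.
move=> kn gg i /andP[_ ik]; congr Num.min; rewrite /Xseq.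
by rewrite !(key_Yseq kn _ gg) // (leq_trans (leq_pred _)).
Qed.

Lemma hX_bounds (g : config) i : (0 < i < n)%N -> 0 <= hX g i <= c i.
Proof.
case: i => // i /andP[_ ik]; have /andP[c0 _] := c4 (ik : (0 < i.+1 < n)%N).
have /andP[x0 _] := Xseq_bounds R v ik g.
by rewrite le_min x0 c0 ge_min lexx orbT.
Qed.

Lemma mgf_upper k : (k < n)%N ->
  \sum_(g : config) expR (theta * \sum_(1 <= i < k.+1) (hX g i - (mu i + M%:R^-1)))
  <= expR (2 * theta ^+ 2 * \sum_(1 <= i < k.+1) C i ^+ 2) * #|{: config}|%:R.
Proof.
elim: k => [|k IH] kn.
  rewrite big_geq // mulr0 expR0 mul1r; under eq_bigr do rewrite big_geq // mulr0 expR0.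
  by rewrite sumr_const.
have kb : (0 < k.+1 < n)%N by [].
pose W (g : config) := expR (theta * \sum_(1 <= i < k.+1) (hX g i - (mu i + M%:R^-1))).
pose Z (g : config) := hX g k.+1 - (mu k.+1 + M%:R^-1).
have W0 g : 0 <= W g by apply: expR_ge0.
have Wkey g g' : key R v k g = key R v k g' -> W g = W g'.
  move=> gg; congr (expR (_ * _)); apply: eq_big_nat => i ik.
  by rewrite (key_hX kn gg).
have ZC g : `|Z g| <= C k.+1.
  have /andP[x0 x1] := hX_bounds g kb.
  by rewrite /Z norm_sub_le ?muC // ?addr_ge0 ?invr_ge0 // x0 (le_trans x1) ?cC.
have WZ : \sum_g W g * Z g <= 0.
  under eq_bigr do rewrite /Z mulrBr; rewrite sumrB subr_le0 -mulr_suml mulrC.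
  exact: mean_upper.
rewrite (eq_bigr (fun g => W g * expR (theta * Z g))); last first.
  by move=> g _; rewrite big_nat_recr //= mulrDr expRD.
apply: le_trans (mgf_step W0 ZC theta0 WZ) _.
have -> : expR (2 * theta ^+ 2 * \sum_(1 <= i < k.+2) C i ^+ 2) * #|{: config}|%:R =
  expR (2 * (theta * C k.+1) ^+ 2) *
  (expR (2 * theta ^+ 2 * \sum_(1 <= i < k.+1) C i ^+ 2) * #|{: config}|%:R).
  by rewrite mulrA -expRD big_nat_recr //=; congr (expR _ * _); ring.
by rewrite ler_wpM2l ?expR_ge0 // IH // ltnW.
Qed.

Lemma mgf_lower k : (k < n)%N ->
  \sum_(g : config) (Y g k.-1 <= eta)%R%:R *
     expR (theta * \sum_(1 <= i < k.+1) (nu i - hX g i))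
  <= expR (2 * theta ^+ 2 * \sum_(1 <= i < k.+1) C i ^+ 2) * #|{: config}|%:R.
Proof.
have /andP[eta0 eta1] := etab.
elim: k => [|k IH] kn.
  rewrite big_geq // mulr0 expR0 mul1r.
  under eq_bigr do rewrite big_geq // mulr0 expR0 /= (ltW eta0) mulr1.
  by rewrite sumr_const.
have kb : (0 < k.+1 < n)%N by [].
pose W (g : config) := (Y g k <= eta)%R%:R *
  expR (theta * \sum_(1 <= i < k.+1) (nu i - hX g i)).
pose Z (g : config) := nu k.+1 - hX g k.+1.
have W0 g : 0 <= W g by rewrite mulr_ge0 // expR_ge0.
have Wkey g g' : key R v k g = key R v k g' -> W g = W g'.
  move=> gg; rewrite /W (key_Yseq kn (leqnn k) gg); congr (_ * expR (_ * _)).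
  by apply: eq_big_nat => i ik; rewrite (key_hX kn gg).
have ZC g : `|Z g| <= C k.+1.
  have /andP[x0 x1] := hX_bounds g kb.
  have mu0 : 0 <= mu k.+1 by rewrite invr_ge0.
  have e0 : 0 <= 1 - 4 * eta by lra.
  rewrite /Z norm_sub_le // ?x0 ?(le_trans x1) ?cC // mulr_ge0 //=.
  apply: le_trans (muC kb); rewrite ler_wpDr ?invr_ge0 // ler_piMl //; lra.
have WZ : \sum_g W g * Z g <= 0.
  under eq_bigr do rewrite /Z mulrBr; rewrite sumrB subr_le0 -mulr_suml mulrC.
  apply: le_trans (mean_lower kn W0 Wkey (c4 kb) etab (etaM kb) _).
    rewrite ler_wpM2r ?sumr_ge0 // ler_wpM2r ?invr_ge0 //.
    by have := ceta kb; lra.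
  by move=> g; rewrite /W; case: leP => //; rewrite mul0r eqxx.
rewrite (eq_bigr (fun g => W g * expR (theta * Z g))); last first.
  by move=> g _; rewrite big_nat_recr //= mulrDr expRD mulrA.
apply: le_trans (mgf_step W0 ZC theta0 WZ) _.
have -> : expR (2 * theta ^+ 2 * \sum_(1 <= i < k.+2) C i ^+ 2) * #|{: config}|%:R =
  expR (2 * (theta * C k.+1) ^+ 2) *
  (expR (2 * theta ^+ 2 * \sum_(1 <= i < k.+1) C i ^+ 2) * #|{: config}|%:R).
  by rewrite mulrA -expRD big_nat_recr //=; congr (expR _ * _); ring.
rewrite ler_wpM2l ?expR_ge0 //; apply: le_trans _ (IH (ltnW kn)).
apply: ler_sum => g _; rewrite /W ler_wpM2r ?expR_ge0 // ler_nat.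
case: leP => // le; rewrite (le_trans _ le) //.
exact: (Yseq_le v (label_gt0 R g) (@label_inj V R N g) (leq_pred k) (ltnW kn)).
Qed.

Lemma count_upper k t : (k < n)%N ->
  #|[pred g : config | t < \sum_(1 <= i < k.+1) (hX g i - (mu i + M%:R^-1))]|%:R <=
  expR (2 * theta ^+ 2 * \sum_(1 <= i < k.+1) C i ^+ 2 - theta * t) * #|{: config}|%:R.
Proof.
move=> kn; apply: (@le_trans _ _ (\sum_(g : config)
  expR (theta * \sum_(1 <= i < k.+1) (hX g i - (mu i + M%:R^-1))) * expR (- (theta * t)))).
  apply: markov_count => g; first by rewrite mulr_ge0 ?expR_ge0.
  by rewrite inE => lt; rewrite -expRD -[leLHS]expR0 ler_expR subr_ge0 ler_wpM2l // ltW.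
by rewrite -[leLHS]mulr_suml expRD mulrAC ler_wpM2r ?expR_ge0 // mgf_upper.
Qed.

Lemma count_lower k t : (k < n)%N ->
  #|[pred g : config | (Y g k.-1 <= eta) &&
      (t < \sum_(1 <= i < k.+1) (nu i - hX g i))]|%:R <=
  expR (2 * theta ^+ 2 * \sum_(1 <= i < k.+1) C i ^+ 2 - theta * t) * #|{: config}|%:R.
Proof.
move=> kn; apply: (@le_trans _ _ (\sum_(g : config) (Y g k.-1 <= eta)%R%:R *
  expR (theta * \sum_(1 <= i < k.+1) (nu i - hX g i)) * expR (- (theta * t)))).
  apply: markov_count => g; first by rewrite !mulr_ge0 ?expR_ge0.
  rewrite inE => /andP[-> lt]; rewrite mul1r -expRD -[leLHS]expR0 ler_expR subr_ge0.
  by rewrite ler_wpM2l // ltW.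
by rewrite -[leLHS]mulr_suml expRD mulrAC ler_wpM2r ?expR_ge0 // mgf_lower.
Qed.

Lemma count_jump k (x : R) : (0 < k < n)%N -> 0 <= x <= 1 -> (k * (n - k) <= M)%N ->
  #|[pred g : config | x < Xg g k]|%:R <=
  expR (1 - x * (k * (n - k))%:R) * #|{: config}|%:R.
Proof.
case: k => // k /= kn /andP[x0 x1] mM; have M0 : 0 < M%:R :> R by rewrite ltr0n.
pose j := Num.truncn (x * M%:R).
have j1 : j%:R <= x * M%:R by rewrite truncn_le // mulr_ge0 // ltW.
have j2 : x * M%:R < j.+1%:R by exact: truncnS_gt.
have jM : (j <= M)%N by rewrite -(ler_nat R) (le_trans j1) // ler_piMl // ltW.
apply: (@le_trans _ _ (\sum_(g : config) 1 * (j%:R / M%:R < Xg g k.+1)%R%:R)).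
  apply: markov_count => g; first by rewrite mul1r.
  rewrite inE => lt; rewrite mul1r (le_lt_trans _ lt) //.
  by rewrite ler_pdivrMr.
apply: le_trans (tail_upper (W := fun=> 1) kn _ _ jM) _ => //.
rewrite sumr_const ler_wpM2r //; apply: le_trans (exp_le_expR _ _) _.
  by rewrite ler_pdivrMr // mul1r ler_nat.
rewrite ler_expR; set m := (_ * _)%N in mM *.
have : x <= j%:R / M%:R + M%:R^-1.
  by rewrite -[X in _ + X]mul1r -mulrDl natr1 ler_pdivlMr // ltW.
move=> /(ler_wpM2r (ler0n R m)); rewrite mulrDl.
have : M%:R^-1 * m%:R <= 1 :> R by rewrite mulrC ler_pdivrMr // mul1r ler_nat.
rewrite -[1 - _]opprB lerN2 lerBlDr => h1 h2; apply: le_trans h2 _.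
by rewrite lerD2l.
Qed.

End Deviations.

(** * Numerical estimates *)

Section Sums.
Variable R : realType.

Lemma sum_min_le (f : nat -> R) n : (forall i, 0 <= f i) ->
  \sum_(1 <= i < n) f (minn i (n - i)) <= 2 * \sum_(1 <= i < n) f i.
Proof.
move=> f0; rewrite mulr_natl mulr2n [in X in _ <= _ + X]big_nat_rev -big_split /=.
apply: ler_sum => i _; rewrite subSS.
by case: leqP => _; rewrite ?lerDl ?lerDr.
Qed.

Lemma ln_le_subr1 (x : R) : 0 < x -> ln x <= x - 1.
Proof. by move=> x0; have := @le_ln1Dx R (x - 1); rewrite addrCA subrr addr0; apply; lra. Qed.

Lemma harmonic_le n : (0 < n)%N -> \sum_(1 <= i < n) i%:R^-1 <= 1 + ln n%:R :> R.
Proof.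
case: n => // n _; apply: (@le_trans _ _ (\sum_(1 <= i < n.+2) i%:R^-1)).
  by rewrite [leRHS]big_nat_recr //= lerDl invr_ge0.
elim: n => [|n IH]; first by rewrite big_nat1 ln1 addr0 invr1.
rewrite big_nat_recr //=; apply: le_trans (lerD IH (lexx _)) _.
rewrite -addrA lerD2l -lerBrDl -opprB -ln_div ?posrE ?ltr0n // lerNr.
apply: le_trans (ln_le_subr1 _) _; first by rewrite divr_gt0 ?ltr0n.
have x0 : 0 < n.+2%:R :> R by rewrite ltr0n.
have -> : n.+1%:R = n.+2%:R - 1 :> R by rewrite -[n.+2%:R]natr1 addrK.
by rewrite mulrBl mulfV ?gt_eqF // mul1r addrAC subrr add0r.
Qed.

Lemma sum_inv_le n : (0 < n)%N ->
  \sum_(1 <= i < n) (i * (n - i))%:R^-1 <= 2 * (1 + ln n%:R) / n%:R :> R.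
Proof.
move=> n0; have n0' : 0 < n%:R :> R by rewrite ltr0n.
rewrite (eq_big_nat _ _ (F2 := fun i => n%:R^-1 * (i%:R^-1 + (n - i)%:R^-1))); last first.
  move=> i /andP[i0 ni].
  rewrite natrM (natrB _ (ltnW ni)).
  have i0' : i%:R != 0 :> R by rewrite pnatr_eq0 -lt0n.
  have ni' : n%:R - i%:R != 0 :> R by rewrite subr_eq0 eqr_nat gtn_eqF.
  have : n%:R != 0 :> R by rewrite gt_eqF.
  move: (n%:R : R) (i%:R : R) i0' ni' => a b b0 ab a0.
  by field; rewrite b0 ab a0.
have rev : \sum_(1 <= i < n) (n - i)%:R^-1 = \sum_(1 <= i < n) i%:R^-1 :> R.
  rewrite big_nat_rev /=; apply: eq_big_nat => i /andP[i0 ni].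
  by rewrite add1n subSS subKn // ltnW.
rewrite -mulr_sumr big_split /= rev mulrC ler_wpM2r ?invr_ge0 ?(ltW n0') //.
by have := harmonic_le n0; lra.
Qed.

Lemma sum_inv_pow32_le n : \sum_(1 <= i < n) Num.sqrt i%:R / i%:R ^+ 2 <= 3 :> R.
Proof.
suff H m : \sum_(1 <= i < m.+2) Num.sqrt i%:R / i%:R ^+ 2 <= 3 - 2 / Num.sqrt m.+1%:R :> R.
  case: n => [|[|n]]; [by rewrite big_geq|by rewrite big_geq|apply: le_trans (H n) _].
  by rewrite gerBl divr_ge0 // sqrtr_ge0.
elim: m => [|m IH]; first by rewrite big_nat1 sqrtr1 expr1n !divr1; lra.
rewrite big_nat_recr //=; apply: le_trans (lerD IH (lexx _)) _.
have a0 : 0 < Num.sqrt m.+1%:R :> R by rewrite sqrtr_gt0 ltr0n.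
have b0 : 0 < Num.sqrt m.+2%:R :> R by rewrite sqrtr_gt0 ltr0n.
have ab : Num.sqrt m.+1%:R <= Num.sqrt m.+2%:R :> R by rewrite ler_sqrt ?ler0n // ler_nat.
have b2 : m.+2%:R = Num.sqrt m.+2%:R ^+ 2 :> R by rewrite sqr_sqrtr.
have a2 : Num.sqrt m.+2%:R ^+ 2 = Num.sqrt m.+1%:R ^+ 2 + 1 :> R.
  by rewrite !sqr_sqrtr // natr1.
rewrite [X in _ / X ^+ 2]b2; move: (Num.sqrt m.+1%:R : R) (Num.sqrt m.+2%:R : R) a0 b0 ab a2 {b2 IH} => a b a0 b0 ab a2.
have -> : b / b ^+ 2 ^+ 2 = (b ^+ 3)^-1 by field; rewrite gt_eqF.
have ba0 : 0 < a + b by rewrite addr_gt0.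
have d : b - a = (a + b)^-1.
  apply: (mulIf (lt0r_neq0 ba0)); rewrite mulVf ?gt_eqF //; lra.
have e : 2 / a - 2 / b = 2 / (a * b * (a + b)).
  rewrite invfM -d; field; rewrite !gt_eqF //.
suff : (b ^+ 3)^-1 <= 2 / a - 2 / b by lra.
rewrite e ler_pdivlMr ?mulr_gt0 // ler_pdivrMl ?exprn_gt0 //.
have -> : b ^+ 3 * 2 = b * b * (b + b) by ring.
by rewrite ler_pM ?lerD ?ler_pM // ?mulr_ge0 ?addr_ge0 // ltW.
Qed.

End Sums.

(* All powers of [ln n] are written as integral powers of [u = (ln n)^(1/160)];
   the exponent is large enough for [ln (ln n) <= 160 u] to be negligible. *)
Section ParameterBounds.
Variables (R : realType) (n : nat) (u : R).
Hypotheses (u1000 : 1000%:R <= u) (lnn : ln n%:R = u ^+ 160).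

Let u0 : 0 < u. Proof. by apply: lt_le_trans u1000; rewrite ltr0n. Qed.
Let u1 : 1 <= u. Proof. by apply: le_trans u1000; rewrite ler1n. Qed.

Lemma n_gt0 : (0 < n)%N.
Proof.
rewrite lt0n; apply/eqP => n0; have := lnn; rewrite n0 ln0 // => /esym/eqP.
by rewrite expf_eq0 gt_eqF.
Qed.

Let n0 : 0 < n%:R :> R. Proof. by rewrite ltr0n n_gt0. Qed.

Lemma n_expR : n%:R = expR (u ^+ 160) :> R.
Proof. by rewrite -lnn lnK // posrE. Qed.

Lemma pow_le_n : 4 * (u ^+ 160) ^+ 4 <= n%:R.
Proof.
have L : 4%:R * 5%:R ^+ 5 <= u ^+ 160.
  apply: (@le_trans _ _ (u * u ^+ 5)); last by rewrite -exprS ler_weXn2l.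
  by rewrite ler_pM ?exprn_ge0 // ?lerXn2r ?nnegrE ?(ltW u0) // (le_trans _ u1000) // ler_nat.
rewrite n_expR; move: (u ^+ 160) L => l L.
have l0 : 0 <= l by apply: le_trans L; rewrite mulr_ge0 // exprn_ge0.
rewrite [X in expR X](_ : l = 5%:R * (l / 5%:R)); last by field.
rewrite expRM_natl; apply: (@le_trans _ _ ((l / 5%:R) ^+ 5)); last first.
  rewrite lerXn2r ?nnegrE ?expR_ge0 ?divr_ge0 //.
  by apply: le_trans (expR_ge1Dx _); rewrite lerDr.
have -> : (l / 5%:R) ^+ 5 = l / 5%:R ^+ 5 * l ^+ 4 by rewrite expr_div_n exprS; ring.
by rewrite ler_wpM2r ?exprn_ge0 // ler_pdivlMr ?exprn_gt0.
Qed.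

Definition minR (i : nat) : R := (minn i (n - i))%:R.
(* Dominates the truncation level [ck i], through [ln s <= 4 s^(1/4)]. *)
Definition jump_bound i : R := u ^+ 2 * Num.sqrt (Num.sqrt (minR i)) / (minR i * n%:R).

Lemma minR_ge1 i : (0 < i < n)%N -> 1 <= minR i.
Proof. by move=> /andP[i0 ni]; rewrite ler1n leq_min i0 subn_gt0. Qed.

Lemma minR_prod i : (0 < i < n)%N -> minR i * n%:R / 2 <= (i * (n - i))%:R.
Proof.
move=> /andP[i0 ni]; rewrite ler_pdivrMr // -!natrM ler_nat.
by rewrite /minn; case: ltnP => h; clear -h i0 ni; nia.
Qed.

Lemma sqrt_sqrt_ge1 (s : R) : 1 <= s -> 1 <= Num.sqrt (Num.sqrt s).
Proof.
move=> s1; have h : 1 <= Num.sqrt s by rewrite -[leLHS]sqrtr1 ler_sqrt //; lra.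
by rewrite -[leLHS]sqrtr1 ler_sqrt //; lra.
Qed.

Lemma ln_le_sqrt_sqrt (s : R) : 1 <= s -> ln s <= 4 * Num.sqrt (Num.sqrt s).
Proof.
move=> s1; have q1 := sqrt_sqrt_ge1 s1; set q := Num.sqrt _ in q1 *.
have -> : s = q ^+ 4.
  by rewrite (_ : 4 = 2 * 2)%N // exprM !sqr_sqrtr // ?sqrtr_ge0 //; lra.
rewrite lnXn; last by lra.
by rewrite -mulr_natl; have := ln_le_subr1 (_ : 0 < q); lra.
Qed.

Lemma ln_ln_n : 0 <= ln (ln n%:R : R) <= 160 * u.
Proof.
rewrite lnn; apply/andP; split; first by rewrite ln_ge0 // exprn_ege1.
by rewrite lnXn // -mulr_natl; have := ln_le_subr1 u0; lra.
Qed.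

Lemma ck_numerator i : (0 < i < n)%N ->
  ln (ln n%:R : R) <= 2 * ln (minn i (n - i))%:R + ln (ln n%:R) <=
  168 * u * Num.sqrt (Num.sqrt (minR i)).
Proof.
move=> ib; have s1 := minR_ge1 ib; have q1 := sqrt_sqrt_ge1 s1.
have := ln_le_sqrt_sqrt s1; have := ln_ge0 s1; rewrite -/(minR i).
have /andP[_ l2] := ln_ln_n; set q := Num.sqrt _ in q1 * => h0 h1.
apply/andP; split; first by lra.
have : u <= u * q by rewrite ler_peMr // ltW.
have : q <= u * q by rewrite ler_peMl //; lra.
lra.
Qed.

Lemma ck_ge0 i : (0 < i < n)%N -> 0 <= ck (R := R) (n := n) i.
Proof.
move=> ib; have /andP[h _] := ck_numerator ib; have /andP[h' _] := ln_ln_n.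
by rewrite divr_ge0 //; lra.
Qed.

Lemma ck_le i : (0 < i < n)%N -> ck (R := R) (n := n) i <= jump_bound i.
Proof.
move=> ib; have s1 := minR_ge1 ib; have m := minR_prod ib.
have sn : 0 < minR i * n%:R by rewrite mulr_gt0 //; lra.
have m0 : 0 < (i * (n - i))%:R :> R by apply: lt_le_trans m; rewrite divr_gt0.
have /andP[_ h] := ck_numerator ib; rewrite /ck ler_pdivrMr //.
apply: le_trans h _; rewrite /jump_bound [leRHS]mulrAC ler_pdivlMr //.
set q := Num.sqrt _; have q0 : 0 <= q by apply: sqrtr_ge0.
have uu : 336 * u <= u ^+ 2.
  by rewrite expr2 ler_wpM2r ?(ltW u0) // (le_trans _ u1000) // ler_nat.
have := ler_wpM2r (mulr_ge0 q0 (ltW m0)) uu.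
have := ler_wpM2l (mulr_ge0 (ltW u0) q0) m.
set d := (i * _)%:R; set e := minR i * n%:R.
move=> h1 h2; apply: le_trans (_ : 336 * u * (q * d) <= _); first by lra.
by rewrite -[leRHS]mulrA.
Qed.

Lemma inv_le_jump i : (0 < i < n)%N -> (i * (n - i))%:R^-1 <= jump_bound i.
Proof.
move=> ib; have s1 := minR_ge1 ib; have m := minR_prod ib; have q1 := sqrt_sqrt_ge1 s1.
have sn : 0 < minR i * n%:R by rewrite mulr_gt0 //; lra.
have m0 : 0 < (i * (n - i))%:R :> R by apply: lt_le_trans m; rewrite divr_gt0.
rewrite -[leLHS]mul1r ler_pdivrMr // /jump_bound [leRHS]mulrAC ler_pdivlMr // mul1r.
set q := Num.sqrt _ in q1 *.
have uu : 2 <= u ^+ 2.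
  by rewrite expr2 -[leLHS]mulr1 ler_pM // (le_trans _ u1000) // ler_nat.
have := ler_pM (ltW (ltr0Sn R 1)) ler01 uu q1.
rewrite -/q => /(ler_wpM2r (ltW m0)).
by move: m; set d := (i * _)%:R; set e := minR i * n%:R; lra.
Qed.

Lemma ck_le4 i : (0 < i < n)%N -> ck (R := R) (n := n) i <= 4^-1.
Proof.
move=> ib; apply: le_trans (ck_le ib) _; have s1 := minR_ge1 ib.
have s0 : 0 < minR i by lra.
have q2 : Num.sqrt (Num.sqrt (minR i)) <= minR i.
  have q1 := sqrt_sqrt_ge1 s1; have h : minR i = Num.sqrt (Num.sqrt (minR i)) ^+ 4.
    by rewrite (_ : 4 = 2 * 2)%N // exprM !sqr_sqrtr // ?sqrtr_ge0 // ltW.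
  by rewrite [leRHS]h -[leLHS]expr1 ler_weXn2l.
have nu : 4 * u ^+ 2 <= n%:R.
  by apply: le_trans pow_le_n; rewrite ler_wpM2l // -exprM ler_weXn2l.
rewrite /jump_bound ler_pdivrMr ?mulr_gt0 //.
have := ler_pM (sqrtr_ge0 _) (mulr_ge0 (ler0n R 4) (exprn_ge0 2 (ltW u0))) q2 nu.
by set q := Num.sqrt _; set e := minR i * n%:R; lra.
Qed.

Lemma expR_ck i : (0 < i < n)%N ->
  expR (- (ck (R := R) (n := n) i * (i * (n - i))%:R)) <= (u ^+ 160)^-1.
Proof.
move=> ib; have s1 := minR_ge1 ib; have m := minR_prod ib.
have sn : 0 < minR i * n%:R by rewrite mulr_gt0 //; lra.
have m0 : 0 < (i * (n - i))%:R :> R by apply: lt_le_trans m; rewrite divr_gt0.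
rewrite /ck divfK ?gt_eqF // expRN lef_pV2 ?posrE ?expR_gt0 ?exprn_gt0 //.
rewrite -[leLHS](lnK (x := u ^+ 160)) ?posrE ?exprn_gt0 // ler_expR -lnn.
by have /andP[] := ck_numerator ib.
Qed.

Lemma sum_jump_sqr k : (k < n)%N ->
  \sum_(1 <= i < k.+1) jump_bound i ^+ 2 <= 6 * u ^+ 4 / n%:R ^+ 2.
Proof.
move=> kn; apply: (@le_trans _ _ (\sum_(1 <= i < n) jump_bound i ^+ 2)).
  rewrite (@big_cat_nat _ _ _ k.+1 1 n) //= lerDl sumr_ge0 // => i _; exact: sqr_ge0.
pose f (i : nat) : R := Num.sqrt i%:R / i%:R ^+ 2.
apply: (@le_trans _ _ (u ^+ 4 / n%:R ^+ 2 * \sum_(1 <= i < n) f (minn i (n - i)))).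
  rewrite mulr_sumr; apply: ler_sum_nat => i ib; have s1 := minR_ge1 ib.
  rewrite /jump_bound /f -/(minR i) expr_div_n !exprMn sqr_sqrtr ?sqrtr_ge0 //.
  by rewrite invfM le_eqVlt; apply/orP; left; apply/eqP; ring.
have -> : 6 * u ^+ 4 / n%:R ^+ 2 = u ^+ 4 / n%:R ^+ 2 * (2 * 3) by ring.
rewrite ler_wpM2l ?divr_ge0 ?exprn_ge0 ?(ltW u0) //.
apply: le_trans (sum_min_le _ _) _ => [i|].
  by rewrite divr_ge0 ?sqrtr_ge0 // exprn_ge0.
by rewrite ler_wpM2l // sum_inv_pow32_le.
Qed.

End ParameterBounds.

Lemma Yseq_sum (V : finType) (R : realType) E (lam : {set V} -> R) v k :
  Yseq E lam v k = \sum_(1 <= i < k.+1) Xseq E lam v i.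
Proof.
elim: k => [|k IH]; first by rewrite big_geq.
by rewrite big_nat_recr //= -IH /Xseq /= addrC subrK.
Qed.

Lemma bool3_lt1 (R : realType) (a b c : bool) :
  ~~ (1 <= a%:R + b%:R + c%:R :> R) -> a%:R + b%:R + c%:R = 0 :> R.
Proof. by case: a b c => [] [] []; rewrite -?natrD ?ler1n. Qed.

Lemma bool3_eq0 (R : realType) (a b c : bool) :
  a%:R + b%:R + c%:R = 0 :> R -> [/\ ~~ a, ~~ b & ~~ c].
Proof.
move=> /eqP; rewrite -!natrD pnatr_eq0.
by case: a; case: b; case: c.
Qed.

Lemma sum_bool_card (R : realType) (I : finType) (P : pred I) :
  \sum_i (P i)%:R = #|P|%:R :> R.
Proof.
rewrite -sum1_card natr_sum [RHS]big_mkcond; apply: eq_bigr => i _.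
by rewrite unfold_in; case: (P i).
Qed.

Lemma ler_sum_term (R : realType) (I J : finType) (P : pred J) (F : I -> J -> R) i j :
  (forall i j, 0 <= F i j) -> P j -> F i j <= \sum_i \sum_(j | P j) F i j.
Proof.
move=> F0 Pj; apply: (@le_trans _ _ (\sum_(j | P j) F i j)).
  by rewrite (bigD1 j) // lerDl sumr_ge0.
by rewrite [leRHS](bigD1 i) // lerDl sumr_ge0 // => i' _; rewrite sumr_ge0.
Qed.

Section FiniteBound.
Variables (R : realType) (n : nat) (u : R) (N : nat).
Hypotheses (u1000 : 1000%:R <= u) (lnn : ln n%:R = u ^+ 160).
Hypotheses (NM : ((n ^ 2).+1 ^ 2 <= N.+1)%N)
  (uM : 2 * (n ^ 2).+1%:R * u ^+ 160 <= N.+1%:R).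
Local Notation M := N.+1.
Local Notation config := (config 'I_n N).
Local Notation Y g v := (Yseq (complete_edges 'I_n) (label R g) v).
Local Notation Xg g v := (Xseq (complete_edges 'I_n) (label R g) v).
Local Notation c := (@ck R n).
Local Notation hX g v i := (hatX (label R g) v i).
Local Notation mu i := ((i * (n - i)).+1%:R^-1 : R).
Let eta : R := (u ^+ 160)^-1.
Let theta : R := n%:R * u ^+ 120.
Let t : R := u ^+ 128 / n%:R.
Local Notation nu i := ((1 - 4 * eta) * mu i).
Local Notation x i := (u ^+ 320 / (i * (n - i))%:R).

Let u0 : 0 < u. Proof. by apply: lt_le_trans u1000; rewrite ltr0n. Qed.
Let u1 : 1 <= u. Proof. by apply: le_trans u1000; rewrite ler1n. Qed.
Let n0 : (0 < n)%N. Proof. exact: n_gt0 u1000 lnn. Qed.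
Let n0' : 0 < n%:R :> R. Proof. by rewrite ltr0n. Qed.
Let M0 : 0 < M%:R :> R. Proof. by rewrite ltr0n. Qed.

Let mul_le_sqr i : (0 < i < n)%N -> (0 < i * (n - i) <= n ^ 2)%N.
Proof. by move=> /andP[i0 ni]; rewrite muln_gt0 i0 subn_gt0 ni /=; nia. Qed.

Let eta0 : 0 < eta. Proof. by rewrite invr_gt0 exprn_gt0. Qed.

Let eta4 : eta <= 4^-1.
Proof.
rewrite /eta lef_pV2 ?posrE ?exprn_gt0 // (@le_trans _ _ u) //.
  by apply: le_trans u1000; rewrite ler_nat.
by rewrite -[leLHS]expr1 ler_weXn2l.
Qed.

Let muC i : (0 < i < n)%N -> mu i + M%:R^-1 <= jump_bound n u i.
Proof.
move=> ib; apply: le_trans (inv_le_jump u1000 lnn ib).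
have /andP[m0 mn] := mul_le_sqr ib; set m := (i * _)%N in m0 mn *.
have h : M%:R^-1 <= (m * m.+1)%:R^-1 :> R.
  have mm : (0 < m * m.+1)%N by rewrite muln_gt0 m0.
  rewrite lef_pV2 ?posrE; [rewrite ler_nat; apply: leq_trans NM|by []|by rewrite ltr0n].
  by rewrite -mulnn leq_mul //; apply: leqW.
apply: le_trans (lerD (lexx _) h) _; rewrite natrM invfM -[in X in _ + _ * X]natr1.
have m0' : 0 < m%:R :> R by rewrite ltr0n.
rewrite -[m.+1%:R]natr1 le_eqVlt; apply/orP; left; apply/eqP; field.
by rewrite !gt_eqF // addr_gt0.
Qed.

Let etaM i : (0 < i < n)%N -> 2 * (i * (n - i)).+1%:R <= eta * M%:R.
Proof.
move=> ib; have /andP[_ mn] := mul_le_sqr ib.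
rewrite /eta ler_pdivlMl ?exprn_gt0 // mulrC; apply: le_trans uM.
by rewrite ler_wpM2r ?exprn_ge0 ?(ltW u0) // ler_wpM2l // ler_nat ltnS.
Qed.

Let c_bounds i : (0 < i < n)%N -> 0 <= c i <= 4^-1.
Proof. by move=> ib; rewrite (ck_ge0 u1000 lnn ib) (ck_le4 u1000 lnn ib). Qed.

Let exponent : 2 * theta ^+ 2 * (6 * u ^+ 4 / n%:R ^+ 2) - theta * t <=
  - 3 - 2 * u ^+ 160 - u ^+ 240.
Proof.
have -> : 2 * theta ^+ 2 * (6 * u ^+ 4 / n%:R ^+ 2) = 12 * u ^+ 244.
  by rewrite /theta (exprD u 240 4) (exprM u 120 2); field; rewrite gt_eqF.
have -> : theta * t = u ^+ 248.
  by rewrite /theta /t (exprD u 120 128); field; rewrite gt_eqF.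
have h1 : u ^+ 160 <= u ^+ 244 by rewrite ler_weXn2l.
have h2 : u ^+ 240 <= u ^+ 244 by rewrite ler_weXn2l.
have h3 : 1 <= u ^+ 244 by rewrite exprn_ege1.
have h4 : 18 * u ^+ 244 <= u ^+ 248.
  apply: (@le_trans _ _ (u * u ^+ 244)); last by rewrite -exprS ler_weXn2l.
  by rewrite ler_wpM2r ?exprn_ge0 ?(ltW u0) // (le_trans _ u1000) // ler_nat.
lra.
Qed.

Let exponent_le k : (k < n)%N ->
  2 * theta ^+ 2 * (\sum_(1 <= i < k.+1) jump_bound n u i ^+ 2) - theta * t <=
  - 3 - 2 * u ^+ 160 - u ^+ 240.
Proof.
move=> /(sum_jump_sqr u1000) S; apply: le_trans exponent; rewrite lerD2r.
have th : 0 <= 2 * theta ^+ 2 by apply: mulr_ge0 => //; exact: sqr_ge0.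
exact: ler_wpM2l th _ _ S.
Qed.

Let exponent' : 1 - u ^+ 320 <= - 3 - 2 * u ^+ 160 - u ^+ 240.
Proof.
have h2 : u ^+ 160 <= u ^+ 240 by rewrite ler_weXn2l.
have h3 : 1 <= u ^+ 240 by rewrite exprn_ege1.
have h4 : 18 * u ^+ 240 <= u ^+ 320.
  apply: (@le_trans _ _ (u * u ^+ 240)); last by rewrite -exprS ler_weXn2l.
  by rewrite ler_wpM2r ?exprn_ge0 ?(ltW u0) // (le_trans _ u1000) // ler_nat.
lra.
Qed.

Local Notation tail := (expR (- 3 - 2 * u ^+ 160 - u ^+ 240) * #|{: config}|%:R).

Lemma count_upper_v v k : (k < n)%N ->
  #|[pred g : config | t < \sum_(1 <= i < k.+1) (hX g v i - (mu i + M%:R^-1))]|%:R <= tail.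
Proof.
move=> kn.
have th0 : 0 <= theta by rewrite mulr_ge0 // exprn_ge0 // ltW.
have := @count_upper 'I_n R N v c (jump_bound n u) theta th0.
rewrite card_ord => /(_ c_bounds (fun i ib => ck_le u1000 lnn ib) muC k t kn) H.
by apply: le_trans H _; rewrite ler_wpM2r // ler_expR exponent_le.
Qed.

Lemma count_lower_v v k : (k < n)%N ->
  #|[pred g : config | (Y g v k.-1 <= eta) &&
      (t < \sum_(1 <= i < k.+1) (nu i - hX g v i))]|%:R <= tail.
Proof.
move=> kn.
have th0 : 0 <= theta by rewrite mulr_ge0 // exprn_ge0 // ltW.
have etab : 0 < eta <= 4^-1 by rewrite eta0.
have := @count_lower 'I_n R N v c (jump_bound n u) eta theta th0 etab.
rewrite card_ord => /(_ c_bounds (fun i ib => ck_le u1000 lnn ib) muC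
  (fun i ib => expR_ck u1000 lnn ib) etaM k t kn) H.
by apply: le_trans H _; rewrite ler_wpM2r // ler_expR exponent_le.
Qed.

Lemma count_jump_v v k : (0 < k < n)%N ->
  #|[pred g : config | x k < Xg g v k]|%:R <= tail.
Proof.
move=> kn; have /andP[m0 mn] := mul_le_sqr kn.
have m0' : 0 < (k * (n - k))%:R :> R by rewrite ltr0n.
have := @count_jump 'I_n R N v k (x k); rewrite card_ord => /(_ kn) H.
apply: le_trans (H _ _) _.
- rewrite divr_ge0 ?exprn_ge0 ?(ltW u0) //= ler_pdivrMr // mul1r.
  apply: (@le_trans _ _ (n%:R / 2)).
    have := pow_le_n u1000 lnn.
    have : u ^+ 320 <= (u ^+ 160) ^+ 4 by rewrite -exprM ler_weXn2l.
    have : 0 <= u ^+ 320 by rewrite exprn_ge0 // ltW.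
    lra.
  have h := minR_prod R kn; apply: (le_trans _ h); have := minR_ge1 R kn => s1.
  by rewrite -mulrA ler_peMl // divr_ge0.
- by apply: leq_trans mn _; apply: leq_trans NM; rewrite -[leqRHS]mulnn (leq_trans (leqnSn _)) // leq_pmulr.
- by rewrite ler_wpM2r // ler_expR divfK ?gt_eqF // exponent'.
Qed.

Definition dev_ok (lam : {set 'I_n} -> R) : bool :=
  [forall v : 'I_n, forall k : 'I_n, (0 < k)%N ==>
    (`|hatY lam v k - \sum_(1 <= i < k.+1) mu i| <= 7 / 4 * (u ^+ 128 / n%:R))].

(* The last event controls untruncated jumps: if it never happens, then all
   arrival labels are at most [eta]. *)
Let bad_term (g : config) (v k : 'I_n) : R :=
  (t < \sum_(1 <= i < k.+1) (hX g v i - (mu i + M%:R^-1)))%R%:R +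
  ((Y g v k.-1 <= eta) && (t < \sum_(1 <= i < k.+1) (nu i - hX g v i)))%R%:R +
  (x k < Xg g v k)%R%:R.

Let bad_term_ge0 g v k : 0 <= bad_term g v k. Proof. by rewrite !addr_ge0. Qed.

Let sum_inv k : (k < n)%N -> \sum_(1 <= i < k.+1) (i * (n - i))%:R^-1 <= 4 * u ^+ 160 / n%:R.
Proof.
move=> kn; apply: (@le_trans _ _ (\sum_(1 <= i < n) (i * (n - i))%:R^-1)).
  by rewrite (@big_cat_nat _ _ _ k.+1 1 n) // lerDl sumr_ge0.
apply: le_trans (sum_inv_le R n0) _; rewrite lnn ler_wpM2r ?invr_ge0 ?(ltW n0') //.
have : 1 <= u ^+ 160 by rewrite exprn_ege1.
by move: (u ^+ 160) => l; lra.
Qed.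

Let sum_mu_le k : (k < n)%N -> \sum_(1 <= i < k.+1) mu i <= 4 * u ^+ 160 / n%:R.
Proof.
move=> kn; apply: le_trans (sum_inv kn); apply: ler_sum_nat => i /andP[i0 ik].
have ib : (0 < i < n)%N by rewrite i0 (leq_trans ik).
have /andP[m0 _] := mul_le_sqr ib.
by rewrite lef_pV2 ?posrE ?ltr0n // ler_nat.
Qed.

Let sum_x_le k : (k < n)%N -> \sum_(1 <= i < k.+1) x i <= eta.
Proof.
move=> kn; rewrite -mulr_sumr.
have h : 0 <= u ^+ 320 by rewrite exprn_ge0 // ltW.
apply: le_trans (ler_wpM2l h (sum_inv kn)) _.
rewrite mulrA ler_pdivrMr // /eta ler_pdivlMl ?exprn_gt0 //.
apply: le_trans (pow_le_n u1000 lnn); rewrite -exprM le_eqVlt; apply/orP; left; apply/eqP.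
by rewrite (exprD u 320 320) (exprD u 160 160); move: (u ^+ 160) => l; ring.
Qed.

Let good_dev g v : (forall k : 'I_n, (0 < k)%N -> bad_term g v k = 0) ->
  forall k : 'I_n, (0 < k)%N ->
  `|hatY (label R g) v k - \sum_(1 <= i < k.+1) mu i| <= 7 / 4 * (u ^+ 128 / n%:R).
Proof.
move=> nb.
have good k : (0 < k)%N -> (k < n)%N ->
    [/\ \sum_(1 <= i < k.+1) (hX g v i - (mu i + M%:R^-1)) <= t,
     Y g v k.-1 <= eta -> \sum_(1 <= i < k.+1) (nu i - hX g v i) <= t & Xg g v k <= x k].
  move=> k0 kn; have /bool3_eq0[] := nb (Ordinal kn) k0.
  rewrite -!leNgt negb_and -leNgt => h1 h2 h3; split=> // Yk.
  by move: h2; rewrite Yk.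
move=> k k0; have kn := ltn_ord k.
have Yk : Y g v k.-1 <= eta.
  have k1 : (k.-1 < n)%N by apply: leq_ltn_trans kn; apply: leq_pred.
  apply: le_trans (sum_x_le k1); rewrite Yseq_sum; apply: ler_sum_nat => i /andP[i0 ik].
  by have [] := good i i0 (leq_trans ik k1).
have [up /(_ Yk) low _] := good k k0 kn.
have un : 0 <= n%:R^-1 :> R by rewrite invr_ge0 ltW.
have kM : k%:R * M%:R^-1 <= 4^-1 * t.
  have nM : 4 * (n%:R * n%:R) <= M%:R :> R.
    by rewrite -!natrM ler_nat; apply: leq_trans NM; clear; nia.
  have kn' : k%:R <= n%:R :> R by rewrite ler_nat ltnW.
  have uge : 1 <= u ^+ 128 by rewrite exprn_ege1.
  rewrite ler_pdivrMr //; apply: (@le_trans _ _ (4^-1 * n%:R^-1 * M%:R)).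
    rewrite mulrAC ler_pdivlMr // ler_pdivlMl //; apply: le_trans nM.
    by rewrite ler_pM2l // ler_wpM2r // ltW.
  rewrite ler_wpM2r ?(ltW M0) // ler_wpM2l // /t.
  by rewrite ler_peMl.
have e16 : 4 * eta * \sum_(1 <= i < k.+1) mu i <= 2^-1 * t.
  have eta04 : 0 <= 4 * eta by rewrite mulr_ge0 // ltW.
  apply: le_trans (ler_wpM2l eta04 (sum_mu_le kn)) _.
  have -> : 4 * eta * (4 * u ^+ 160 / n%:R) = 16 * n%:R^-1.
    by rewrite /eta; field; rewrite ?gt_eqF ?exprn_gt0.
  rewrite /t mulrA ler_wpM2r // ler_pdivlMl //.
  apply: (@le_trans _ _ u); last by rewrite -[leLHS]expr1 ler_weXn2l.
  by apply: le_trans u1000; rewrite -natrM ler_nat.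
have upE : \sum_(1 <= i < k.+1) (hX g v i - (mu i + M%:R^-1)) =
    hatY (label R g) v k - \sum_(1 <= i < k.+1) mu i - k%:R * M%:R^-1.
  rewrite sumrB big_split sumr_const_nat subSS subn0 mulr_natl.
  by rewrite opprD addrA.
have lowE : \sum_(1 <= i < k.+1) (nu i - hX g v i) =
    \sum_(1 <= i < k.+1) mu i - hatY (label R g) v k - 4 * eta * \sum_(1 <= i < k.+1) mu i.
  by rewrite sumrB -mulr_sumr mulrBl mul1r addrAC.
rewrite -/t; move: up low; rewrite upE lowE.
have t0 : 0 <= t by rewrite divr_ge0 ?exprn_ge0 ?(ltW u0) // ltW.
move: (hatY _ _ _) (4 * eta * _) e16 (k%:R / _) kM t0 => h a ha b hb t0.
move: (\sum_(1 <= i < k.+1) mu i) (t : R) ha hb t0 => m t' ha hb t0 h1 h2.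
by rewrite ler_norml; apply/andP; split; lra.
Qed.

Lemma bad_count : #|[pred g : config | ~~ dev_ok (label R g)]|%:R <=
  expR (- u ^+ 240) * #|{: config}|%:R.
Proof.
apply: (@le_trans _ _ (\sum_g \sum_v \sum_(k : 'I_n | (0 < k)%N) bad_term g v k)).
  apply: markov_count => g; first by rewrite !sumr_ge0 // => v _; rewrite sumr_ge0.
  rewrite inE => /forallPn[v /forallPn[k]]; rewrite negb_imply => /andP[k0 far].
  have [/existsP[k' /andP[k0' b1]]|/existsPn nb] :=
     boolP [exists k' : 'I_n, (0 < k')%N && (1 <= bad_term g v k')].
    by apply: (le_trans b1); exact: (@ler_sum_term R _ _ (fun k : 'I_n => (0 < k)%N) (bad_term g) v k' (bad_term_ge0 g) k0').
  exfalso; apply: (negP far); apply: good_dev => // k' k0'.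
  by have := nb k'; rewrite k0'; exact: bool3_lt1.
rewrite exchange_big; under eq_bigr do rewrite exchange_big.
apply: (@le_trans _ _ (\sum_(v : 'I_n) \sum_(k : 'I_n) 3 * tail)).
  apply: ler_sum => v _; rewrite [leLHS]big_mkcond; apply: ler_sum => k _; case: ifP => k0; last first.
    by rewrite mulr_ge0 // mulr_ge0 // expR_ge0.
  rewrite !big_split /=.
  have := count_upper_v v (ltn_ord k); have := count_lower_v v (ltn_ord k).
  have kb : (0 < k < n)%N by rewrite k0 /=.
  by have := count_jump_v v kb; rewrite -!sum_bool_card; lra.
rewrite !sumr_const card_ord -[leLHS]mulr_natr -[X in X * _ <= _]mulr_natr.
have -> : expR (- 3 - 2 * u ^+ 160 - u ^+ 240) =
    expR (- 3) * (n%:R * n%:R)^-1 * expR (- u ^+ 240) :> R.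
  rewrite !expRD !expRN (n_expR u1000 lnn) -expRD; congr (_ * _^-1 * _).
  by congr expR; rewrite mulr_natl mulr2n.
have e3 : 3 * expR (- 3) <= 1 :> R.
  rewrite expRN ler_pdivrMr ?expR_gt0 // mul1r.
  by apply: le_trans (expR_ge1Dx _); rewrite lerDr.
have -> : 3 * (expR (- 3) * (n%:R * n%:R)^-1 * expR (- u ^+ 240) * #|{: config}|%:R) * n%:R * n%:R =
  (3 * expR (- 3)) * (expR (- u ^+ 240) * #|{: config}|%:R).
  move: (expR (- 3)) (expR (- u ^+ 240)) (#|{: config}|%:R : R) n0' => a b d.
  by move: (n%:R : R) => m m0; field; rewrite gt_eqF.
by rewrite ler_piMl // mulr_ge0 // expR_ge0.
Qed.
End FiniteBound.

(** * From the grid to independent uniform labels *)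

Section Measurability.
Variables (R : realType) (n : nat) (d : measure_display) (Omega : measurableType d)
  (P : probability Omega R) (lambda : {set 'I_n} -> {RV P >-> R}).
Local Notation lam w := (fun e : {set 'I_n} => lambda e w).
Local Notation order_type := {ffun {set 'I_n} * {set 'I_n} -> bool}.

Definition label_order (w : Omega) : order_type := [ffun p => lambda p.1 w <= lambda p.2 w].

Lemma measurable_lambda e : measurable_fun setT (fun w => lambda e w : R).
Proof. exact: measurable_funPT. Qed.

Lemma measurable_label_order (A : set order_type) : measurable [set w | A (label_order w)]%classic.
Proof.
have -> : [set w | A (label_order w)]%classic =
    (\bigcup_(r in A) \bigcap_(p in [set: {set 'I_n} * {set 'I_n}])
       [set w | (lambda p.1 w <= lambda p.2 w) = r p])%classic.
  apply/seteqP; split=> w /=.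
    by move=> Aw; exists (label_order w) => // p _ /=; rewrite ffunE.
  move=> [r Ar wr]; suff -> : label_order w = r by [].
  by apply/ffunP => p; rewrite ffunE; exact: wr.
apply: fin_bigcup_measurable => [|r _]; first exact: finite_finset.
apply: fin_bigcap_measurable => [|p _]; first exact: finite_finset.
have mb : measurable_fun setT (fun w => lambda p.1 w <= lambda p.2 w).
  by apply: measurable_fun_ler; exact: measurable_lambda.
by have := mb measurableT [set r p]%classic; rewrite setTI; apply.
Qed.

Lemma next_edge_label_order v k w w' : label_order w = label_order w' ->
  new_edge (lam w) v k = new_edge (lam w') v k.
Proof.
move=> /ffunP ww; have same : {in complete_edges 'I_n &, forall e f,
    (lam w e <= lam w f) = (lam w' e <= lam w' f)}.
  by move=> e f _ _; have := ww (e, f); rewrite !ffunE.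
rewrite /new_edge /tree (tree_seq_order v k same).
by apply: next_edge_order => //; exact: tree_seq_edges.
Qed.

Lemma measurable_new_edge v k e : measurable [set w | new_edge (lam w) v k = e]%classic.
Proof.
pose A : set order_type := [set r | exists w, label_order w = r /\ new_edge (lam w) v k = e]%classic.
have -> : [set w | new_edge (lam w) v k = e]%classic = [set w | A (label_order w)]%classic.
  apply/seteqP; split=> w /=; first by move=> we; exists w.
  by move=> [w' [/(next_edge_label_order v k) ww <-]].
exact: measurable_label_order.
Qed.

Lemma measurable_Yseq v k :
  measurable_fun setT (fun w => Yseq (complete_edges 'I_n) (lam w) v k).
Proof.
case: k => [|k]; first exact: measurable_cst.
have -> : (fun w => Yseq (complete_edges 'I_n) (lam w) v k.+1) =
    (fun w => \sum_(e : {set 'I_n}) \1_[set w | new_edge (lam w) v k = e]%classic w * lambda e w).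
  apply/funext => w; rewrite YseqS (bigD1 (new_edge (lam w) v k)) //= big1 => [|e].
    by rewrite addr0 indicE mem_set ?mul1r.
  by move=> /eqP ne; rewrite indicE memNset ?mul0r // => /esym.
apply: measurable_sum => e; apply: measurable_funM; last exact: measurable_lambda.
by apply: measurable_indic; exact: measurable_new_edge.
Qed.

Lemma measurable_hatY v k : measurable_fun setT (fun w => hatY (lam w) v k).
Proof.
apply: measurable_sum => i; apply: measurable_minr; last exact: measurable_cst.
by apply: measurable_funB; exact: measurable_Yseq.
Qed.

Lemma measurable_deviation (s : nat -> R) b :
  measurable [set w | forall (v : 'I_n) (k : nat), (1 <= k <= n.-1)%N ->
    `|hatY (lam w) v k - s k| <= b]%classic.
Proof.
have -> : [set w | forall (v : 'I_n) (k : nat), (1 <= k <= n.-1)%N ->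
    `|hatY (lam w) v k - s k| <= b]%classic =
   (\bigcap_(v in [set: 'I_n]) \bigcap_(k in [set k | (1 <= k <= n.-1)%N])
     [set w | `|hatY (lam w) v k - s k| <= b])%classic.
  apply/seteqP; split=> w /= H; first by move=> v _ k kn; exact: H.
  by move=> v k kn; exact: H.
apply: fin_bigcap_measurable => [|v _]; first exact: finite_finset.
apply: bigcap_measurableType => k _.
have mb : measurable_fun setT (fun w => `|hatY (lam w) v k - s k| <= b).
  apply: measurable_fun_ler; last exact: measurable_cst.
  apply: measurableT_comp => //; apply: measurable_funB; last exact: measurable_cst.
  exact: measurable_hatY.
by have := mb measurableT [set true]%classic; rewrite setTI; apply.
Qed.
End Measurability.

Section Ties.
Variables (V : finType) (R : realType) (N : nat).
Local Notation config := (config V N).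
Local Notation edge := (edge V).

Lemma card_tie (e f : edge) : e != f ->
  (#|[pred g : config | g e == g f]| * N.+1 <= #|{: config}|)%N.
Proof.
move=> ef; have -> : (#|[pred g : config | g e == g f]| * N.+1 =
    #|finset.setX [set g : config | g e == g f] [set: 'I_N.+1]|)%N.
  by rewrite cardsX cardsT card_ord cardsE.
rewrite -[leqRHS]cardsT.
pose h (p : config * 'I_N.+1) : config := [ffun x => if x == f then p.2 else p.1 x].
rewrite -(card_in_imset (f := h)) ?subset_leq_card ?finset.subsetT //.
move=> [g c] [g' c']; rewrite !finset.in_setX !inE /= !andbT => /eqP ge /eqP ge' /ffunP H.
have cc : c = c' by have := H f; rewrite !ffunE eqxx.
have gg x : x != f -> g x = g' x by move=> xf; have := H x; rewrite !ffunE (negPf xf).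
congr pair => //; apply/ffunP => x; have [->|] := eqVneq x f; last exact: gg.
by rewrite -ge -ge' gg.
Qed.

Lemma card_not_injective :
  #|[pred g : config | ~~ injectiveb g]|%:R <= (#|{: edge}| ^ 2)%:R / N.+1%:R * #|{: config}|%:R :> R.
Proof.
apply: (@le_trans _ _ (\sum_(g : config) \sum_(e : edge) \sum_(f : edge | e != f) (g e == g f)%:R)).
  apply: markov_count => g; first by rewrite !sumr_ge0 // => e _; rewrite sumr_ge0.
  rewrite inE => /injectivePn[e [f ef gef]].
  rewrite (bigD1 e) //= (bigD1 f) //= gef eqxx -addrA lerDl addr_ge0 ?sumr_ge0 // => i _.
  by rewrite sumr_ge0.
rewrite exchange_big; under eq_bigr do rewrite exchange_big.
apply: (@le_trans _ _ (\sum_(e : edge) \sum_(f : edge) (#|{: config}|%:R / N.+1%:R : R))).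
  apply: ler_sum => e _; rewrite [leLHS]big_mkcond; apply: ler_sum => f _.
  case: ifP => ef; last by rewrite divr_ge0.
  by rewrite sum_bool_card ler_pdivlMr ?ltr0n // -natrM ler_nat card_tie.
rewrite !sumr_const -mulrnA -[leLHS]mulr_natl.
by rewrite mulnn mulrA mulrAC.
Qed.
End Ties.

Section Cells.
Variables (R : realType) (n : nat) (d : measure_display) (Omega : measurableType d)
  (P : probability Omega R) (lambda : {set 'I_n} -> {RV P >-> R}) (N : nat).
Hypothesis clique : random_temporal_clique lambda.
Local Notation M := N.+1.
Local Notation config := (config 'I_n N).
Local Notation edge := (edge 'I_n).

Definition slot (i : 'I_M) : set R := `[i%:R / M%:R, i.+1%:R / M%:R[%classic.

Definition slot_of (g : config) (e : {set 'I_n}) : set R :=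
  if insub e is Some f then slot (g f) else setT.

Definition cell (g : config) : set Omega :=
  (\bigcap_(e in [set` complete_edges 'I_n]) ((lambda e : Omega -> R) @^-1` slot_of g e))%classic.

Let M0 : 0 < M%:R :> R. Proof. by rewrite ltr0n. Qed.

Lemma measurable_slot_of g e : measurable (slot_of g e).
Proof. by rewrite /slot_of; case: insub => // f; rewrite /slot; exact: measurable_itv. Qed.

Lemma uniform_slot i : uniform_prob (@ltr01 R) (slot i) = (M%:R^-1)%:E.
Proof.
have lt : i%:R / M%:R < i.+1%:R / M%:R :> R by rewrite ltr_pM2r ?invr_gt0 // ltr_nat.
rewrite /uniform_prob (eq_integral (fun=> 1%:E)); last first.
  move=> y; rewrite inE /slot /= in_itv /= => /andP[y0 y1].
  have h0 : 0 <= y by apply: le_trans y0; rewrite divr_ge0.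
  have h1 : y <= 1.
    by apply: le_trans (ltW y1) _; rewrite ler_pdivrMr // mul1r ler_nat ltn_ord.
  by rewrite /uniform_pdf h0 h1 subr0 invr1.
rewrite integral_cst; last by rewrite /slot; exact: measurable_itv.
rewrite mul1e /slot /= lebesgue_measure_itv /= lte_fin lt -EFinD -mulrBl.
by rewrite -[i.+1%:R]natr1 addrAC subrr add0r mul1r.
Qed.

Lemma measurable_cell g : measurable (cell g).
Proof.
apply: fin_bigcap_measurable => [|e _]; first exact: finite_finset.
have := measurable_lambda lambda e measurableT (measurable_slot_of g e).
by rewrite setTI.
Qed.

Lemma prob_cell g : P (cell g) = ((M%:R^-1) ^+ #|{: edge}|)%:E.
Proof.
case: clique => indep unif.
rewrite /cell (indep (complete_edges 'I_n)) //; last exact: measurable_slot_of.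
rewrite (eq_bigr (fun=> (M%:R^-1)%:E)).
  by rewrite prodEFin prodr_const card_sig.
move=> e eE; have := unif e eE (slot_of g e) (measurable_slot_of g e).
rewrite /distribution /pushforward => ->.
by rewrite /slot_of insubT uniform_slot.
Qed.

Lemma cell_label g w (e : {set 'I_n}) (eE : e \in complete_edges 'I_n) : cell g w ->
  (g (exist _ e eE))%:R / M%:R <= lambda e w < (g (exist _ e eE)).+1%:R / M%:R.
Proof.
by move=> /(_ e eE); rewrite /slot_of insubT /= /slot /= in_itv.
Qed.

Lemma cell_inj g g' w : cell g w -> cell g' w -> g = g'.
Proof.
move=> gw gw'; apply/ffunP => -[e eE].
have /andP[a1 a2] := cell_label eE gw; have /andP[b1 b2] := cell_label eE gw'.
apply: val_inj => /=; apply/eqP; rewrite eqn_leq.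
have := le_lt_trans a1 b2; have := le_lt_trans b1 a2.
by rewrite !ltr_pM2r ?invr_gt0 // !ltr_nat !ltnS => -> ->.
Qed.

Lemma prob_cells (G : pred config) :
  P (\bigcup_(g in [set` G]) cell g)%classic = (#|G|%:R / #|{: config}|%:R)%:E.
Proof.
rewrite measure_fin_bigcup; [|exact: finite_finset| |by move=> g _; exact: measurable_cell].
  rewrite -(bigfs _ (r := enum {: config})) ?enum_uniq //; last first.
    by move=> g _; rewrite mem_enum.
  rewrite (eq_bigr (fun=> ((M%:R^-1) ^+ #|{: edge}|)%:E)) => [|g _]; last exact: prob_cell.
  rewrite sumEFin big_enum_cond /= sumr_const; congr _%:E.
  by rewrite card_ffun card_ord natrX -[LHS]mulr_natl exprVn.
by move=> g g' _ _ [w [gw gw']]; exact: cell_inj gw gw'.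
Qed.

Section Close.
Variables (g : config) (w : Omega).
Hypotheses (g_inj : injective g) (gw : cell g w).
Local Notation lam := (fun e : {set 'I_n} => lambda e w).

Lemma cell_order :
  {in complete_edges 'I_n &, forall e f, (lam e <= lam f) = (label R g e <= label R g f)}.
Proof.
move=> e f eE fE; have /andP[e1 e2] := cell_label eE gw; have /andP[f1 f2] := cell_label fE gw.
rewrite -[in RHS](SubK (edge) eE) -[in RHS](SubK (edge) fE) !label_val.
rewrite ler_pM2r ?invr_gt0 //.
have /andP[r1 r2] := offset_bounds R (exist _ e eE : edge).
have /andP[s1 s2] := offset_bounds R (exist _ f fE : edge).
have lt (i j : 'I_M) (x y r s : R) : (i < j)%N -> x < i.+1%:R / M%:R -> j%:R / M%:R <= y ->
    r < 1 -> 0 < s -> (x < y) && (i%:R + r < j%:R + s).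
  move=> ij xi jy r1' s0'; have ij' : i.+1%:R <= j%:R :> R by rewrite ler_nat.
  rewrite (lt_le_trans xi) ?(le_trans _ jy) ?ler_pM2r ?invr_gt0 //=.
  by move: ij'; rewrite -natr1; lra.
have [ij|ji|/val_inj/g_inj[ef]] := ltngtP (g (exist _ e eE)) (g (exist _ f fE)).
- by have /andP[/ltW -> /ltW ->] := lt _ _ _ _ _ _ ij e2 f1 r2 s1.
- by have /andP[h1 h2] := lt _ _ _ _ _ _ ji f2 e1 s2 r1; rewrite !leNgt h1 h2.
- by subst f; rewrite (bool_irrelevance fE eE) !lexx.
Qed.

Lemma cell_close e : e \in complete_edges 'I_n -> `|lam e - label R g e| <= M%:R^-1.
Proof.
move=> eE; have := cell_label eE gw.
rewrite -[in label _ _ _](SubK (edge) eE) label_val.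
have /andP[r1 r2] := offset_bounds R (exist _ e eE : edge).
set i := g _; rewrite -[i.+1%:R]natr1 !mulrDl mul1r.
have iM : 0 <= M%:R^-1 :> R by rewrite invr_ge0.
have rM : 0 <= offset R (exist _ e eE : edge) / M%:R <= M%:R^-1.
  by rewrite mulr_ge0 ?(ltW r1) //= ler_piMl // ltW.
move: rM; set a := i%:R / M%:R; set b := offset _ _ / M%:R; move: (M%:R^-1 : R) iM => m m0.
by move=> /andP[b0 b1] /andP[l1 l2]; rewrite ler_norml; apply/andP; split; lra.
Qed.

Lemma cell_Yseq v k : (k < n)%N ->
  `|Yseq (complete_edges 'I_n) lam v k - Yseq (complete_edges 'I_n) (label R g) v k| <= M%:R^-1.
Proof.
case: k => [|k] kn; first by rewrite subrr normr0 invr_ge0.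
rewrite !YseqS; have -> : new_edge lam v k = new_edge (label R g) v k.
  rewrite /new_edge /tree (tree_seq_order v k cell_order).
  by apply: next_edge_order; [exact: cell_order|exact: tree_seq_edges].
by apply: cell_close; apply: next_bdry_edge; [exact: label_gt0|rewrite card_ord].
Qed.

Lemma min_lipschitz (x y c : R) : `|Num.min x c - Num.min y c| <= `|x - y|.
Proof.
have h1 := ler_norm (x - y); have h2 := ler_norm (y - x); rewrite distrC in h2.
rewrite !minEle; case: (leP x c) => xc; case: (leP y c) => yc //.
- by rewrite ler_norml; apply/andP; split; lra.
- by rewrite ler_norml; apply/andP; split; lra.
- by rewrite subrr normr0.
Qed.

Lemma cell_hatY v k : (k < n)%N ->
  `|hatY lam v k - hatY (label R g) v k| <= k%:R * (2 / M%:R).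
Proof.
move=> kn; rewrite /hatY -sumrB; apply: le_trans (ler_norm_sum _ _ _) _.
apply: (@le_trans _ _ (\sum_(1 <= i < k.+1) (2 / M%:R : R))); last first.
  by rewrite sumr_const_nat subSS subn0 -[leLHS]mulr_natl.
apply: ler_sum_nat => i /andP[i0 ik]; apply: le_trans (min_lipschitz _ _ _) _.
have Yi := cell_Yseq v (leq_trans ik kn).
have Yj := cell_Yseq v (leq_ltn_trans (leq_pred i) (leq_trans ik kn)).
rewrite /Xseq; set a := Yseq _ _ _ i in Yi *; set b := Yseq _ (label _ _) _ i in Yi *.
set a' := Yseq _ _ _ i.-1 in Yj *; set b' := Yseq _ (label _ _) _ i.-1 in Yj *.
have -> : a - a' - (b - b') = (a - b) - (a' - b') by ring.
apply: le_trans (ler_normB _ _) _; apply: le_trans (lerD Yi Yj) _.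
by rewrite mulr_natl mulr2n.
Qed.
End Close.

End Cells.

Lemma log_scale (R : realType) (b : R) : 1 <= b -> exists N0 : nat, forall n, (N0 <= n)%N ->
  exists u : R, [/\ b <= u, ln n%:R = u ^+ 160, ln n%:R `^ (8 / 10) = u ^+ 128
    & n%:R `^ (- Num.sqrt (ln n%:R)) = expR (- u ^+ 240)].
Proof.
move=> b1; have b0 : 0 < b by apply: lt_le_trans b1.
exists (Num.truncn (expR (b ^+ 160))).+1 => n Nn.
have nb : expR (b ^+ 160) <= n%:R.
  by apply: le_trans (ltW (truncnS_gt _)) _; rewrite ler_nat.
have n0 : 0 < n%:R :> R by apply: lt_le_trans nb; apply: expR_gt0.
have lb : b ^+ 160 <= ln n%:R.
  by rewrite -[leLHS]expRK ler_ln ?posrE ?expR_gt0.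
have l0 : 0 <= ln (n%:R : R) by apply: le_trans lb; rewrite exprn_ge0 // ltW.
have q0 : 160%:R != 0 :> R by rewrite pnatr_eq0.
pose u : R := ln n%:R `^ (160%:R)^-1.
have u0 : 0 <= u by apply: powR_ge0.
have uE m : u ^+ m = ln n%:R `^ (m%:R / 160%:R).
  by rewrite -powR_mulrn // -powRrM mulrC.
have lu : ln n%:R = u ^+ 160 by rewrite uE mulfV // powRr1.
exists u; split=> //.
- rewrite -(@ler_pXn2r _ 160%N) ?nnegrE //; last exact: ltW.
  by rewrite -lu.
- by rewrite uE; congr (_ `^ _); field.
- have -> : Num.sqrt (ln n%:R) = u ^+ 80.
    by rewrite lu (exprM u 80 2) sqrtr_sqr ger0_norm // exprn_ge0.
  rewrite /powR gt_eqF // lu mulNr; congr expR; congr (- _).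
  by rewrite -exprD.
Qed.

Theorem theorem4p7 (R : realType) :
  exists N : nat, forall n : nat, (N <= n)%N ->
  forall (d : measure_display) (Omega : measurableType d)
    (P : probability Omega R) (lambda : {set 'I_n} -> {RV P >-> R}),
  random_temporal_clique lambda ->
  ((1 - 2 * n%:R `^ (- Num.sqrt (ln n%:R)))%:E <=
   P [set w : Omega | forall (v : 'I_n) (k : nat), (1 <= k <= n.-1)%N ->
        (`| hatY (fun e => lambda e w) v k
           - \sum_(1 <= i < k.+1) ((i * (n - i))%:R + 1)^-1 |
        <= 2 * (ln n%:R) `^ (8 / 10) / n%:R)%R]%classic)%E.
Proof.
have [N0 HN0] := @log_scale R 1000%:R (ler1n _ _).
exists N0 => n /HN0[u [u1000 lnn -> ->]] d Omega P lambda clique.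
have u0 : 0 < u by apply: lt_le_trans u1000; rewrite ltr0n.
have n0 := n_gt0 u1000 lnn; have n0' : 0 < n%:R :> R by rewrite ltr0n.
pose a : R := 2 * (n ^ 2).+1%:R * u ^+ 160.
pose b : R := (#|{: edge 'I_n}| ^ 2)%:R * expR (u ^+ 240).
pose N := ((n ^ 2).+1 ^ 2 + ((Num.truncn a).+1 + (Num.truncn b).+1))%N.
have M0 : 0 < N.+1%:R :> R by rewrite ltr0n.
have NM : ((n ^ 2).+1 ^ 2 <= N.+1)%N by apply: leqW; apply: leq_addr.
have aM : a <= N.+1%:R.
  apply: le_trans (ltW (truncnS_gt _)) _; rewrite ler_nat; apply: leqW.
  by apply: leq_trans (leq_addl _ _); apply: leq_addr.
have bM : b <= N.+1%:R.
  apply: le_trans (ltW (truncnS_gt _)) _; rewrite ler_nat; apply: leqW.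
  by apply: leq_trans (leq_addl _ _); apply: leq_addl.
pose G (g : config 'I_n N) := dev_ok u (label R g) && injectiveb g.
have cG : (1 - 2 * expR (- u ^+ 240)) <= #|G|%:R / #|{: config 'I_n N}|%:R.
  have c0 : 0 < #|{: config 'I_n N}|%:R :> R.
    by rewrite ltr0n card_ffun card_ord expn_gt0.
  rewrite ler_pdivlMr //.
  have cC : #|{: config 'I_n N}|%:R = #|G|%:R + #|predC G|%:R :> R.
    by rewrite -natrD cardC.
  have h1 := bad_count u1000 lnn NM aM.
  have h2 := @card_not_injective 'I_n R N.
  have h3 : #|predC G|%:R <= #|[pred g : config 'I_n N | ~~ dev_ok u (label R g)]|%:R +
     #|[pred g : config 'I_n N | ~~ injectiveb g]|%:R :> R.
    rewrite -natrD ler_nat -cardUI; apply: leq_trans (leq_addr _ _).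
    by apply: subset_leq_card; apply/fintype.subsetP => g; rewrite !inE negb_and.
  have h4 : (#|{: edge 'I_n}| ^ 2)%:R / N.+1%:R <= expR (- u ^+ 240) :> R.
    by rewrite ler_pdivrMr // expRN ler_pdivlMl ?expR_gt0 // mulrC.
  have h5 := ler_wpM2r (ltW c0) h4.
  rewrite mulrBl mul1r lerBlDr [leLHS]cC lerD2l; apply: le_trans h3 _.
  rewrite -mulrA [leRHS]mulr_natl mulr2n; exact: lerD h1 (le_trans h2 h5).
apply: (@le_trans _ _ (P (\bigcup_(g in [set` G]) cell lambda g)%classic)).
  by rewrite (prob_cells clique) lee_fin.
apply: le_measure; rewrite ?inE.
- by apply: fin_bigcup_measurable => [|g _]; [exact: finite_finset|exact: measurable_cell].
- exact: (measurable_deviation lambda (fun k => \sum_(1 <= i < k.+1) ((i * (n - i))%:R + 1)^-1)).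
move=> w [g /= /andP[gdev /injectiveP ginj] gw] v k /andP[k0 kn].
have kn' : (k < n)%N by rewrite -(prednK n0) ltnS.
have := forallP (forallP gdev v) (Ordinal kn'); rewrite k0 => dev.
have close := cell_hatY ginj gw v kn'.
have small : k%:R * (2 / N.+1%:R) <= 4^-1 * (u ^+ 128 / n%:R).
  have nM : 4 * (n%:R * n%:R) <= N.+1%:R :> R.
    by rewrite -!natrM ler_nat; apply: leq_trans NM; clear; nia.
  have kR : k%:R <= n%:R :> R by rewrite ler_nat ltnW.
  have uge : 2 <= u ^+ 128.
    apply: (@le_trans _ _ u); first by apply: le_trans u1000; rewrite ler_nat.
    by rewrite -[leLHS]expr1 ler_weXn2l // (le_trans _ u1000) // ler1n.
  rewrite mulrA ler_pdivrMr //; apply: (@le_trans _ _ (4^-1 * (2 / n%:R) * N.+1%:R)).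
    have -> : 4^-1 * (2 / n%:R) * N.+1%:R = 2 * (4^-1 * N.+1%:R) / n%:R :> R.
      by move: (n%:R^-1 : R) (N.+1%:R : R) => p m; ring.
    rewrite ler_pdivlMr // mulrAC mulrC ler_wpM2l // ler_pdivlMl //.
    by apply: le_trans nM; rewrite ler_wpM2l // ler_wpM2r // ltW.
  by rewrite ler_wpM2r ?(ltW M0) // ler_wpM2l // ler_wpM2r // invr_ge0 ltW.
have -> : \sum_(1 <= i < k.+1) ((i * (n - i))%:R + 1)^-1 =
    \sum_(1 <= i < k.+1) (i * (n - i)).+1%:R^-1 :> R.
  by apply: eq_bigr => i _; rewrite natr1.
rewrite -(subrK (hatY (label R g) v k) (hatY (fun e => lambda e w) v k)) -addrA.
apply: le_trans (ler_normD _ _) _; apply: le_trans (lerD (le_trans close small) dev) _.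
by rewrite -[2 * _ / _]mulrA; lra.
Qed.
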